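(* For every $\varepsilon > 0$ there is a constant $c_\varepsilon > 0$ such that for all sufficiently large real $X$, \[ \int_{0}^{1} \Big| \sum_{n \leqslant X} \lambda(n)\, e(n\alpha) \Big|\, d\alpha \;\geq\; c_\varepsilon\, X^{1/4-\varepsilon}. \]
   Context: $\lambda$ denotes the Liouville function, $\lambda(n) = (-1)^{\Omega(n)}$ where $\Omega(n)$ is the number of prime factors of $n$ counted with multiplicity. $e(x) := e^{2\pi i x}$. *)

(* Defs.v *)
From mathcomp Require Import all_boot all_order all_algebra.
From mathcomp Require Import all_classical all_reals all_analysis.
From mathcomp.real_closed Require Import complex.
Set Implicit Arguments.
Unset Strict Implicit.
Unset Printing Implicit Defensive.
Import Order.TTheory GRing.Theory Num.Theory.
Import numFieldNormedType.Exports.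
Local Open Scope ring_scope.

Definition bigomega (n : nat) : nat := (\sum_(p <- primes n) logn p n)%N.

(* The value at n = 0, where [bigomega 0 = 0], is 1; it plays no role. *)
Definition liouville (n : nat) : int := (-1) ^+ bigomega n.

(* e(x) = exp(2 i pi x), the complex exponential being given by Euler's formula *)
Definition expe {R : realType} (x : R) : R[i] :=
  (cos (2 * pi * x) +i* sin (2 * pi * x))%C.

(* [Num.truncn_ge_nat]: for 0 <= X, n <= truncn X iff n%:R <= X *)
Definition liouville_sum {R : realType} (X a : R) : R[i] :=
  \sum_(1 <= n < (Num.truncn X).+1) (liouville n)%:~R * expe (n%:R * a).

(* Main.v *)
(* The idea is to test S(alpha) = sum_(n <= X) lambda(n) e(n alpha) against a sum
   of translates of one kernel, concentrated near the fractions a/p with p prime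
   up to Q = sqrt X. Let N = Q^2, h(t) = max(0, 1 - t) and
   w(n) = - sum_(d >= 1) (-1)^d h(dn/N).
   Since 1 * lambda is the indicator of the squares, for every y > 0
     sum_m lambda(m) sum_d (-1)^(d+1) h(dm/y) = sum_j h(j^2/y) - 2 sum_j h(2j^2/y)
   is asymptotic to -(2/3)(sqrt 2 - 1) sqrt y: no information on the zeros of
   zeta is needed. As sum_(0 < a < p) e(na/p) = p [p | n] - 1 and
   lambda(pm) = - lambda(m), integrating S against the translates by all a/p of
   K(b) = sum_(n <= N) w(n) e(nb) gives at least a constant times
   sqrt N * sum_p sqrt p, that is, N^(5/4) up to logarithms.
   On the other hand w is bounded by 1 with total variation O(log N), hence
   |K(b)| << min(N, log N / ||b||), and the fractions a/p are 1/N-separated, so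
   the sum of |K(alpha - a/p)| over them is O(N log^2 N) for all alpha.
   Dividing, the L^1 norm of S is at least X^(1/4) up to logarithms. *)

From Pilot Require Import Defs.
From mathcomp Require Import all_boot all_order all_algebra.
From mathcomp Require Import all_classical all_reals all_analysis.
From mathcomp.real_closed Require Import complex.
From mathcomp Require Import ring lra zify.
Set Implicit Arguments.
Unset Strict Implicit.
Unset Printing Implicit Defensive.
Import Order.TTheory GRing.Theory Num.Theory.
Import numFieldNormedType.Exports.
Local Open Scope classical_set_scope.
Local Open Scope ring_scope.

(* Unqualified, [expe] is the natural power of extended reals. *)
Local Notation expe := Pilot.Defs.expe.
Local Notation normc := ComplexField.Normc.normc.

(** * The Liouville function *)

(** Extra elements of [s] contribute [logn p n = 0]. This freedom lets [m] and [n] both be summed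
    over [primes (m * n)], where the valuations add. *)
Lemma bigomega_sum (s : seq nat) (n : nat) :
  uniq s -> {subset primes n <= s} -> (\sum_(p <- s) logn p n)%N = bigomega n.
Proof.
move=> us sub; rewrite (bigID (mem (primes n))) /= [X in (_ + X)%N]big1 ?addn0.
  rewrite -big_filter; apply: perm_big; apply: uniq_perm.
  - exact: filter_uniq.
  - exact: primes_uniq.
  - by move=> p; rewrite mem_filter andbC; case: (boolP (p \in primes n)) => [/sub->|]; rewrite ?andbF.
by move=> p; rewrite -logn_gt0 -eqn0Ngt => /eqP.
Qed.

Lemma liouvilleM (m n : nat) : (0 < m)%N -> (0 < n)%N ->
  liouville (m * n) = liouville m * liouville n.
Proof.
move=> m0 n0; rewrite /liouville -exprD; congr (_ ^+ _).
rewrite -(@bigomega_sum (primes (m * n)) m) ?primes_uniq//; last first.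
  by move=> p; rewrite primesM// => ->.
rewrite -(@bigomega_sum (primes (m * n)) n) ?primes_uniq//; last first.
  by move=> p; rewrite primesM// orbC => ->.
by rewrite -big_split; apply: eq_bigr => p _; rewrite lognM.
Qed.

Lemma liouville_prime (p : nat) : prime p -> liouville p = -1.
Proof.
move=> pp; rewrite /liouville /bigomega primes_prime// big_seq1.
by rewrite logn_prime// eqxx expr1.
Qed.

Lemma mul_square (p m k : nat) : prime p ->
  (exists j, (p ^ k.*2 * m = j * j)%N) <-> (exists j, (m = j * j)%N).
Proof.
move=> pp; split=> [] [j]; last first.
  by move=> ->; exists (p ^ k * j)%N; rewrite -addnn expnD mulnACA.
case: (posnP m) => [->|m0 e]; first by exists 0%N.
have p0 := prime_gt0 pp.
have j0 : (0 < j)%N by case: j e => // /eqP; rewrite mul0n muln_eq0 expn_eq0; lia.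
(* The [p]-adic valuation of [j * j] is at least [2k] and is twice that of [j]. *)
have : (p ^ k %| j)%N.
  rewrite pfactor_dvdn//.
  have /(congr1 (logn p)) := e; rewrite !lognM ?expn_gt0 ?p0// pfactorK//; lia.
case/dvdnP => i ji; exists i; apply/eqP.
rewrite -(@eqn_pmul2l (p ^ k.*2)%N) ?expn_gt0 ?p0// e ji -addnn expnD; apply/eqP; ring.
Qed.

(** Parity of the [p]-adic valuation: [2k + 1] on the left, even on the right. *)
Lemma odd_mul_square (p m k : nat) : prime p -> coprime p m ->
  ~ (exists j, (p ^ k.*2.+1 * m = j * j)%N).
Proof.
move=> pp cpm [j e]; have p0 := prime_gt0 pp.
have m0 : (0 < m)%N.
  by case: m cpm {e} => //; rewrite /coprime gcdn0 => /eqP pe; rewrite pe in pp.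
have j0 : (0 < j)%N by case: j e => // /eqP; rewrite mul0n muln_eq0 expn_eq0; lia.
have /(congr1 (logn p)) := e.
rewrite !lognM ?expn_gt0 ?p0// pfactorK// (logn_coprime cpm); lia.
Qed.

(** The divisors coprime to [p] are those of [m]. The others are [p * e] with [e] dividing
    [p ^ k * m], and the factor [p] flips the sign of [liouville e]. *)
Lemma sum_liouville_step (p k m : nat) : prime p -> coprime p m -> (0 < m)%N ->
  \sum_(d <- divisors (p ^ k.+1 * m)) liouville d =
  \sum_(d <- divisors m) liouville d - \sum_(d <- divisors (p ^ k * m)) liouville d.
Proof.
move=> pp cpm m0; have p0 := prime_gt0 pp.
have n0 i : (0 < p ^ i * m)%N by rewrite muln_gt0 expn_gt0 p0.
rewrite (bigID (fun d => coprime p d)) /=; congr (_ + _).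
  rewrite -big_filter; apply: perm_big; apply: uniq_perm.
  - by rewrite filter_uniq// divisors_uniq.
  - exact: divisors_uniq.
  move=> d; rewrite mem_filter -!dvdn_divisors//.
  apply/andP/idP => [[cpd]|dm]; first by rewrite Gauss_dvdr// coprimeXr// coprime_sym.
  by rewrite dvdn_mull// (coprime_dvdr dm cpm).
rewrite -sumrN -big_filter.
transitivity (\sum_(d <- [seq (p * e)%N | e <- divisors (p ^ k * m)]) liouville d).
  apply: perm_big; apply: uniq_perm.
  - by rewrite filter_uniq// divisors_uniq.
  - rewrite map_inj_uniq ?divisors_uniq// => x y /eqP; rewrite eqn_pmul2l//.
    by move/eqP.
  move=> d; rewrite mem_filter -!dvdn_divisors// prime_coprime// negbK.
  apply/andP/mapP => [[/dvdnP[e ->]]|[e]].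
    rewrite expnS -mulnA mulnC dvdn_pmul2l// => ?; exists e; last by rewrite mulnC.
    by rewrite -dvdn_divisors.
  by rewrite -dvdn_divisors// => ? ->; rewrite dvdn_mulr// expnS -mulnA dvdn_pmul2l.
rewrite big_map; apply: eq_big_seq => e.
rewrite -dvdn_divisors// => /(dvdn_gt0 (n0 _)) e0.
by rewrite liouvilleM// liouville_prime// mulN1r.
Qed.

Lemma sum_liouville_divisors (n : nat) : (0 < n)%N ->
  \sum_(d <- divisors n) liouville d = (`[< exists j, n = (j * j)%N >])%:R.
Proof.
elim/ltn_ind: n => n IH n0.
have [->|n1] := eqVneq n 1%N.
  by rewrite big_seq1 /liouville /bigomega big_nil; rewrite asboolT//; exists 1%N.
have {n1} n1 : (1 < n)%N by lia.
set p := pdiv n; have pp : prime p by rewrite pdiv_prime.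
have p0 := prime_gt0 pp.
have [m] := pfactor_coprime pp n0; rewrite mulnC.
set a := logn p n => cpm nE.
have m0 : (0 < m)%N by move: n0; rewrite nE muln_gt0 => /andP[].
have a0 : (0 < a)%N by rewrite logn_gt0 mem_primes pp n0 pdiv_dvd.
have mn : (m < n)%N.
  rewrite nE -{1}(mul1n m) ltn_pmul2r// -(exp1n a) ltn_exp2r// prime_gt1//.
(* With [t] the divisor sum of [m], the recursion [s -> t - s] started at [t] alternates between [t]
   and 0. *)
have key i : \sum_(d <- divisors (p ^ i * m)) liouville d =
   (~~ odd i)%:R * (`[< exists j, m = (j * j)%N >])%:R.
  elim: i => [|i IHi]; first by rewrite expn0 mul1n IH// mul1r.
  rewrite sum_liouville_step// IHi IH//=; case: (odd i) => /=; ring.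
rewrite nE key -(odd_double_half a).
case: (odd a) => /=; rewrite ?add1n ?add0n /= odd_double/= ?mul0r ?mul1r.
  by rewrite asboolF//; apply: odd_mul_square.
by congr (nat_of_bool _)%:R; apply: asbool_equiv_eq; symmetry; apply: mul_square.
Qed.

(** * A Chebyshev lower bound *)

(** The ratio of consecutive central binomial coefficients is [2 (2n + 1) / (n + 1)], which is at
    least 2. *)
Lemma exp2_le_bin (n : nat) : (2 ^ n <= 'C(n.*2, n))%N.
Proof.
elim: n => [|n IH] //.
have h : (n.+1 * 'C(n.+1.*2, n.+1) = 2 * n.*2.+1 * 'C(n.*2, n))%N.
  apply/eqP; rewrite -(@eqn_pmul2l n.+1)//; apply/eqP.
  rewrite [in LHS]doubleS -mul_bin_diag succnK.
  have := mul_bin_down n.*2.+1 n; rewrite succnK.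
  have -> : (n.*2.+1 - n = n.+1)%N by lia.
  move=> e; rewrite mulnCA -e; nia.
rewrite expnS -(@leq_pmul2l n.+1)// h; nia.
Qed.

Lemma divn_double_sub (m q : nat) : (m.*2 %/ q - (m %/ q).*2 <= 1)%N.
Proof.
case: (posnP q) => [->|q0]; first by rewrite !divn0.
have h1 := divn_eq m q; have h2 := divn_eq m.*2 q.
have h3 := ltn_pmod m q0; nia.
Qed.

(** By Legendre's formula the valuation is the sum over [k] of [floor(2n / p^k) - 2 floor(n / p^k)].
    Each term is at most 1, and it vanishes once [p^k > 2n]. *)
Lemma logn_central_bin (p n : nat) : prime p -> (0 < n)%N ->
  (p ^ logn p 'C(n.*2, n) <= n.*2)%N.
Proof.
move=> pp n0; have p1 := prime_gt1 pp.
suff h : (logn p 'C(n.*2, n) <= trunc_log p n.*2)%N.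
  by apply: leq_trans (trunc_logP p1 _); [rewrite leq_exp2l | rewrite double_gt0].
have E : (logn p 'C(n.*2, n) + (logn p n`!).*2 = logn p n.*2`!)%N.
  rewrite -(@bin_fact n.*2 n); last by lia.
  have -> : (n.*2 - n = n)%N by lia.
  by rewrite !lognM ?bin_gt0 ?muln_gt0 ?fact_gt0//; lia.
set T := trunc_log p n.*2.
have ext m M : (m <= M)%N -> (\sum_(1 <= k < m.+1) m %/ p ^ k = \sum_(1 <= k < M.+1) m %/ p ^ k)%N.
  move=> mM; rewrite [RHS](big_cat_nat (n:=m.+1))//= [X in (_ + X)%N]big_nat_cond.
  rewrite [X in (_ + X)%N]big1 ?addn0// => k /andP[/andP[mk _] _].
  by rewrite divn_small// (leq_trans mk)// ltnW// ltn_expl.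
have F : (logn p 'C(n.*2, n) = \sum_(1 <= k < n.*2.+1) (n.*2 %/ p ^ k - (n %/ p ^ k).*2))%N.
  apply/eqP; rewrite -(eqn_add2r (logn p n`!).*2) E !logn_fact//.
  rewrite (ext n n.*2); last by lia.
  rewrite -[X in (_ + X)%N]mul2n big_distrr/= -big_split /=; apply/eqP; apply: eq_bigr => k _.
  have h1 := divn_eq n (p ^ k); have h2 := divn_eq n.*2 (p ^ k).
  have q0 : (0 < p ^ k)%N by rewrite expn_gt0; lia.
  have h3 := ltn_pmod n q0; have := ltn_pmod n.*2 q0; nia.
have Tn : (T < n.*2.+1)%N.
  by rewrite ltnS (leq_trans _ (trunc_logP p1 _)) ?double_gt0// ltnW// ltn_expl.
rewrite F (big_cat_nat (n:=T.+1))//= [X in (_ + X <= _)%N]big_nat_cond.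
rewrite [X in (_ + X <= _)%N]big1 ?addn0.
  apply: leq_trans (_ : (\sum_(1 <= k < T.+1) 1 <= _)%N).
    by apply: leq_sum => k _; exact: divn_double_sub.
  by rewrite sum_nat_const_nat subn1 muln1.
move=> k /andP[/andP[Tk _] _]; rewrite divn_small ?sub0n//.
by rewrite ltnNge; apply/negP => /(trunc_log_max p1); rewrite -/T leqNgt Tk.
Qed.

Definition prime_pi (n : nat) : nat := (\sum_(0 <= p < n.+1 | prime p) 1)%N.

(** The central binomial coefficient is at least [2 ^ n], and it is a product of prime powers, at
    most one for each prime up to [2n] and each at most [2n]. *)
Lemma prime_pi_lower (n : nat) : (0 < n)%N -> (2 ^ n <= n.*2 ^ prime_pi n.*2)%N.
Proof.
move=> n0; apply: leq_trans (exp2_le_bin n) _.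
have C0 : (0 < 'C(n.*2, n))%N by rewrite bin_gt0; lia.
set c := 'C(_, _) in C0 *.
have sub p : p \in primes c -> (p <= n.*2)%N.
  move=> pc; have pp : prime p by move: pc; rewrite mem_primes => /andP[].
  apply: leq_trans (logn_central_bin pp n0).
  by rewrite -{1}(expn1 p) leq_exp2l ?prime_gt1// logn_gt0.
have -> : c = (\prod_(0 <= p < n.*2.+1 | prime p) p ^ logn p c)%N.
  rewrite [LHS]prod_prime_decomp// prime_decompE big_map /=.
  rewrite [RHS](bigID (mem (primes c))) /= [X in (_ * X)%N]big1 ?muln1.
    rewrite -[RHS]big_filter; apply: perm_big; apply: uniq_perm.
    - exact: primes_uniq.
    - by rewrite filter_uniq// iota_uniq.
    move=> p; rewrite mem_filter mem_index_iota /=.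
    by case: (boolP (p \in primes c)) => pc; rewrite ?andbF// ltnS sub//
      (_ : prime p)//; move: pc; rewrite mem_primes => /andP[].
  by move=> p /andP[_]; rewrite -logn_gt0 -eqn0Ngt => /eqP->.
rewrite /prime_pi expn_sum; apply: leq_prod => p pp; rewrite expn1; exact: logn_central_bin.
Qed.

(** * The weight *)

Lemma alternating_sum_nonincreasing (R : realFieldType) (u : nat -> R) (c : R) (m n : nat) :
  0 <= c ->
  (forall d, (m <= d < n)%N -> 0 <= u d <= c) ->
  (forall d, (m <= d)%N -> (d.+1 < n)%N -> u d.+1 <= u d) ->
  `| \sum_(m <= d < n) (-1) ^+ d * u d | <= c.
Proof.
move=> c0 ub dec; case: (ltnP m n) => [mn|nm]; last by rewrite big_geq// normr0.
(* Normalised by the sign of its first term, the sum lies between 0 and [u m]. This sharper form is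
   what the induction on the length carries. *)
suff /andP[h1 h2] : 0 <= (-1) ^+ m * \sum_(m <= d < n) (-1) ^+ d * u d <= u m.
  have -> : `|\sum_(m <= d < n) (-1) ^+ d * u d| = `|(-1) ^+ m * \sum_(m <= d < n) (-1) ^+ d * u d|.
    by rewrite normrM normrX normrN1 expr1n mul1r.
  rewrite ger0_norm// (le_trans h2)//.
  by have /andP[] : 0 <= u m <= c by apply: ub; rewrite leqnn mn.
move: mn ub dec; move ek : (n - m)%N => k.
elim: k m ek => [|k IH] m ek mn ub dec; first lia.
rewrite big_ltn// mulrDr mulrA -expr2 sqrr_sign mul1r.
case: (ltnP m.+1 n) => [mn'|nm]; last first.
  rewrite big_geq// mulr0 addr0 lexx andbT.
  by have /andP[] : 0 <= u m <= c by apply: ub; rewrite leqnn mn.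
have /andP[h1 h2] : 0 <= (-1) ^+ m.+1 * (\sum_(m.+1 <= d < n) (-1) ^+ d * u d) <= u m.+1.
  apply: IH => //; first lia.
  - by move=> d hd; apply: ub; lia.
  - by move=> d hd; apply: dec; lia.
have h3 := dec m (leqnn m) mn'.
move: h1 h2; rewrite exprS mulN1r mulNr; lra.
Qed.

(** Reversing the order of summation reduces to the nonincreasing case, up to a global sign. *)
Lemma alternating_sum_nondecreasing (R : realFieldType) (u : nat -> R) (c : R) (m n : nat) :
  0 <= c ->
  (forall d, (m <= d < n)%N -> 0 <= u d <= c) ->
  (forall d, (m <= d)%N -> (d.+1 < n)%N -> u d <= u d.+1) ->
  `| \sum_(m <= d < n) (-1) ^+ d * u d | <= c.
Proof.
move=> c0 ub inc; case: (ltnP m n) => [mn|nm]; last by rewrite big_geq// normr0.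
rewrite big_nat_rev /=.
have sgn i : (m <= i < n)%N ->
    (-1) ^+ (m + n - i.+1) * u (m + n - i.+1)%N =
    (-1) ^+ (m + n).+1 * ((-1) ^+ i * u (m + n - i.+1)%N) :> R.
  move=> hi; rewrite mulrA -exprD; congr (_ * _).
  by rewrite -[LHS]signr_odd -[RHS]signr_odd; congr (_ ^+ nat_of_bool _); lia.
rewrite (eq_big_nat _ _ sgn) -big_distrr /= normrM normrX normrN1 expr1n mul1r.
apply: (@alternating_sum_nonincreasing _ (fun i => u (m + n - i.+1)%N)) => //.
- by move=> d hd; apply: ub; lia.
- move=> d md dn.
  have -> : (m + n - d.+1 = (m + n - d.+2).+1)%N by lia.
  by apply: inc; lia.
Qed.

Definition hat {R : realFieldType} (t : R) : R := Num.max 0 (1 - t).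

Lemma hat_small {R : realFieldType} (t : R) : t <= 1 -> hat t = 1 - t.
Proof. by move=> h; rewrite /hat max_r//; lra. Qed.

Lemma hat_large {R : realFieldType} (t : R) : 1 <= t -> hat t = 0.
Proof. by move=> h; rewrite /hat max_l//; lra. Qed.

Lemma hat_ge0 {R : realFieldType} (t : R) : 0 <= hat t.
Proof. by rewrite le_max lexx. Qed.

Lemma hat_le {R : realFieldType} (s t : R) : s <= t -> hat t <= hat s.
Proof.
move=> st; rewrite /hat ge_max le_max lexx /= le_max; apply/orP; right; lra.
Qed.

(** For [n >= 1] the cut at [d <= N] loses nothing, as [hat] vanishes from 1 on. The alternating
    signs keep the weight bounded, whereas the sum without signs would be of size [N / (2n)]. *)
Definition weight {R : realFieldType} (N n : nat) : R :=
  - \sum_(1 <= d < N.+1) (-1) ^+ d * hat (d%:R * n%:R / N%:R).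

Lemma normr_weight_le1 {R : realFieldType} (N n : nat) : `| weight N n : R | <= 1.
Proof.
rewrite normrN; apply: alternating_sum_nonincreasing => //.
- move=> d _; rewrite hat_ge0 /=.
  have h : 0 <= d%:R * n%:R / N%:R :> R by rewrite !mulr_ge0.
  by rewrite (le_trans (hat_le h))// hat_small ?subr0.
- move=> d _ _; apply: hat_le; rewrite ler_wpM2r ?invr_ge0// ler_wpM2r// ler_nat; lia.
Qed.

(* For consecutive arguments the summands increase linearly in [d] up to
   [d ~ N / n] and decrease afterwards. *)
Lemma weight_variation {R : realFieldType} (N n : nat) : (0 < N)%N -> (0 < n)%N ->
  `| weight N n.+1 - weight N n : R | <= 2 / n.+1%:R.
Proof.
move=> N0 n0; rewrite /weight opprK addrC -sumrB.
under eq_bigr do rewrite -mulrBr.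
have Np : 0 < N%:R :> R by rewrite ltr0n.
have np : 0 < n%:R :> R by rewrite ltr0n.
have n1p : 0 < n.+1%:R :> R by rewrite ltr0n.
(* For [d <= D] both hats are in their linear range; for [d > D] the one at [n + 1] is already
   zero. *)
set D := (N %/ n.+1)%N.
have DN : (D <= N)%N by exact: leq_div.
have small d : (d <= D)%N ->
    hat (d%:R * n%:R / N%:R) - hat (d%:R * n.+1%:R / N%:R) = d%:R / N%:R :> R.
  rewrite leq_divRL// => hd.
  have h1 : d%:R * n.+1%:R / N%:R <= 1 :> R by rewrite ler_pdivrMr// mul1r -natrM ler_nat.
  have h2 : d%:R * n%:R / N%:R <= 1 :> R.
    by rewrite ler_pdivrMr// mul1r -natrM ler_nat; nia.
  by rewrite !hat_small// -[n.+1]addn1 natrD; field; rewrite gt_eqF.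
have large d : (D < d)%N ->
    hat (d%:R * n%:R / N%:R) - hat (d%:R * n.+1%:R / N%:R) = hat (d%:R * n%:R / N%:R) :> R.
  rewrite ltn_divLR// => hd; rewrite [X in _ - X]hat_large ?subr0//.
  by rewrite ler_pdivlMr// mul1r -natrM ler_nat ltnW.
rewrite (big_cat_nat (n := D.+1))//=.
apply: (le_trans (ler_normD _ _)).
(* Each of the two monotone ranges contributes at most [1 / (n + 1)]: before the break
   [d / N <= 1 / (n + 1)], after it the hat is at most [1 - n / (n + 1)]. *)
have -> : 2 / n.+1%:R = 1 / n.+1%:R + 1 / n.+1%:R :> R by field; rewrite gt_eqF.
have c0 : 0 <= 1 / n.+1%:R :> R by rewrite divr_ge0.
apply: lerD.
  apply: alternating_sum_nondecreasing => //.
    move=> d /andP[_ hd]; rewrite ltnS in hd; rewrite small// divr_ge0//=.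
    rewrite ler_pdivrMr// mulrAC mul1r ler_pdivlMr// -natrM ler_nat.
    by rewrite -leq_divRL.
  by move=> d _ hd; rewrite !small; try lia; rewrite ler_pM2r ?invr_gt0// ler_nat.
apply: alternating_sum_nonincreasing => //.
  move=> d /andP[hd _]; rewrite large// hat_ge0 /=.
  have h : n%:R / n.+1%:R <= d%:R * n%:R / N%:R :> R.
    rewrite ler_pdivrMr// mulrAC ler_pdivlMr// -!natrM ler_nat.
    by move: hd; rewrite ltn_divLR// => hd; nia.
  rewrite (le_trans (hat_le h))// hat_small; last by rewrite ler_pdivrMr// mul1r ler_nat.
  by rewrite lerBlDr -mulrDl addrC natr1 divff// gt_eqF.
move=> d hd _; rewrite !large//; last lia.
by apply: hat_le; rewrite ler_wpM2r ?invr_ge0// ler_wpM2r// ler_nat; lia.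
Qed.

(** * The complex exponential *)

Lemma normc_sum (R : rcfType) (I : Type) (s : seq I) (P : pred I) (F : I -> R[i]) :
  normc (\sum_(i <- s | P i) F i) <=
  \sum_(i <- s | P i) normc (F i).
Proof.
apply: (big_ind2 (fun x y => normc x <= y)) => //.
  by rewrite Normc.normc0.
by move=> x1 x2 y1 y2 h1 h2; apply: le_trans (le_normcD _ _) (lerD h1 h2).
Qed.

Lemma normc_real (R : rcfType) (x : R) : normc (x%:C)%C = `|x|.
Proof. by rewrite /normc /= expr0n /= addr0 sqrtr_sqr. Qed.

Lemma normc_ge_normr_Re (R : rcfType) (z : R[i]) : `|complex.Re z| <= normc z.
Proof.
case: z => a b /=; rewrite -sqrtr_sqr ler_wsqrtr//; by rewrite lerDl sqr_ge0.
Qed.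

Lemma expeD (R : realType) (x y : R) : expe (x + y) = expe x * expe y.
Proof.
rewrite /expe mulrDr cosD sinD; apply/eqP; rewrite eq_complex /= eqxx /=.
by apply/eqP; ring.
Qed.

Lemma expe0 (R : realType) : expe (0 : R) = 1.
Proof. by rewrite /expe mulr0 cos0 sin0. Qed.

Lemma normc_expe (R : realType) (x : R) : normc (expe x) = 1.
Proof. by rewrite /expe /normc cos2Dsin2 sqrtr1. Qed.

Lemma expe1 (R : realType) : expe (1 : R) = 1.
Proof. by rewrite /expe mulr1 mulr_natl cos2pi sin2pi. Qed.

Lemma expeM_nat (R : realType) (n : nat) (x : R) : expe (n%:R * x) = expe x ^+ n.
Proof.
elim: n => [|n IH]; first by rewrite mul0r expe0 expr0.
by rewrite -natr1 mulrDl mul1r expeD IH exprSr.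
Qed.

Lemma expe_nat (R : realType) (n : nat) : expe (n%:R : R) = 1.
Proof. by rewrite -[n%:R]mulr1 expeM_nat expe1 expr1n. Qed.

Lemma expe_int (R : realType) (k : int) : expe (k%:~R : R) = 1.
Proof.
case: k => n; first by rewrite -pmulrn expe_nat.
rewrite NegzE mulrNz -pmulrn.
have := expe_nat R n.+1; set y := n.+1%:R => ey.
by have := expeD y (- y); rewrite subrr expe0 ey mul1r => <-.
Qed.

Lemma normc_1BexpeN (R : realType) (x : R) :
  normc (1 - expe (- x))%R = normc (1 - expe x).
Proof.
have -> : 1 - expe (- x)%R = - (expe (- x) * (1 - expe x)).
  by rewrite mulrBr mulr1 -expeD addNr expe0 opprB.
by rewrite normcN Normc.normcM normc_expe mul1r.
Qed.

(** Telescoping: with [z = expe x], [1 - z^(m+1) = (1 - z^m) + z^m (1 - z)]. *)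
Lemma normc_1Bexpe_natM (R : realType) (m : nat) (x : R) :
  normc (1 - expe (m%:R * x)) <=
  m%:R * normc (1 - expe x).
Proof.
elim: m => [|m IH]; first by rewrite !mul0r expe0 subrr Normc.normc0.
have -> : 1 - expe (m.+1%:R * x) =
    (1 - expe (m%:R * x)) + expe (m%:R * x) * (1 - expe x).
  by rewrite -natr1 mulrDl mul1r expeD; ring.
apply: le_trans (le_normcD _ _) _.
by rewrite Normc.normcM normc_expe mul1r -natr1 mulrDl mul1r lerD2r.
Qed.

Lemma cos_le0 (R : realType) (x : R) : pi / 2 <= x <= pi + pi / 2 -> cos x <= 0.
Proof.
move=> /andP[h1 h2]; have -> : x = (x - pi) + pi by rewrite subrK.
rewrite cosDpi oppr_le0; apply: cos_ge0_pihalf; apply/andP; split; lra.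
Qed.

(* Some multiple [m t] with [m < 1 / t] lies in [1/4, 3/4]. *)
Lemma normc_1Bexpe_ge_half (R : realType) (t : R) : 0 < t <= 1 / 2 ->
  t <= normc (1 - expe t).
Proof.
move=> /andP[t0 t2]; set z := normc _.
set y := 1 / (4 * t); have y0 : 0 <= y by rewrite divr_ge0// mulr_ge0// ltW.
have yt : y * t = 1 / 4 by rewrite /y; field; rewrite gt_eqF.
set m := (Num.truncn y).+1.
have my : y < m%:R by exact: truncnS_gt.
have my1 : m%:R <= y + 1 by rewrite -natr1 lerD2r truncn_le.
have mt1 : 1 / 4 <= m%:R * t by rewrite -yt ler_pM2r// ltW.
have mt2 : m%:R * t <= 1 / 4 + t.
  by rewrite -yt -[X in _ + X]mul1r -mulrDl ler_pM2r.
have c0 : cos (2 * pi * (m%:R * t)) <= 0.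
  by apply: cos_le0; have := pi_gt0 R => p0; apply/andP; split; nra.
(* The real part of [expe (m t)] is nonpositive, so [m t] is at distance at least 1 from 0 on the
   circle side; dividing by [m] and using [m t <= 3/4 <= 1] gives the claim. *)
have h1 : 1 <= normc (1 - expe (m%:R * t)).
  apply: le_trans (normc_ge_normr_Re _); rewrite /expe /=.
  by rewrite (le_trans _ (ler_norm _))//; lra.
have h2 := le_trans h1 (normc_1Bexpe_natM m t); rewrite -/z in h2.
have m0 : 0 < m%:R :> R by rewrite ltr0n.
rewrite -(ler_pM2l m0) (le_trans _ h2)//; lra.
Qed.

Lemma normc_1Bexpe_ge (R : realType) (t : R) : 0 < t < 1 ->
  Num.min t (1 - t) <= normc (1 - expe t).
Proof.
move=> /andP[t0 t1]; rewrite ge_min; case: (lerP t (1 / 2)) => ht.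
  by rewrite normc_1Bexpe_ge_half ?t0.
apply/orP; right; rewrite -normc_1BexpeN.
have -> : expe (- t)%R = expe (1 - t) by rewrite expeD expe1 mul1r.
apply: normc_1Bexpe_ge_half; apply/andP; split; lra.
Qed.

(** * The kernel *)

Definition harmonic_sum {R : realFieldType} (N : nat) : R := \sum_(1 <= n < N.+1) n%:R^-1.

Definition kernel {R : realType} (N : nat) (b : R) : R[i] :=
  \sum_(1 <= n < N.+1) ((weight N n : R)%:C)%C * expe (n%:R * b).

(** Summation by parts: it converts small variation of the coefficients into decay like
    [1 / |1 - z|]. *)
Lemma abel_geometric (A : comNzRingType) (w : nat -> A) (z : A) (N : nat) :
  (1 - z) * (\sum_(1 <= n < N.+2) w n * z ^+ n) =
  w 1%N * z + \sum_(1 <= n < N.+1) (w n.+1 - w n) * z ^+ n.+1 - w N.+1 * z ^+ N.+2.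
Proof.
elim: N => [|N IH]; first by rewrite big_nat1 big_geq//; ring.
rewrite big_nat_recr//= mulrDr IH [in RHS]big_nat_recr//= !exprS; ring.
Qed.

Lemma harmonic_sum_ge1 {R : realFieldType} (N : nat) : (0 < N)%N -> 1 <= harmonic_sum N :> R.
Proof.
move=> N0; rewrite /harmonic_sum big_ltn// invr1 lerDl; apply: sumr_ge0 => i _.
by rewrite invr_ge0.
Qed.

(** After summation by parts the two boundary terms cost 1 each and the variation costs
    [2 / (n + 1)] at each [n], which adds up to twice the harmonic sum. *)
Lemma kernel_le_inv {R : realType} (N : nat) (b : R) : (0 < N)%N ->
  normc (1 - expe b) * normc (kernel N b) <= 2 * harmonic_sum N.
Proof.
case: N => // N _; rewrite -Normc.normcM /kernel.
under eq_bigr do rewrite expeM_nat.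
rewrite abel_geometric.
apply: le_trans (le_normcD _ _) _; rewrite normcN.
have nz k : normc (expe b ^+ k) = 1 by rewrite -expeM_nat normc_expe.
have h1 : normc ((weight N.+1 N.+1 : R)%:C%C * expe b ^+ N.+2) <= 1.
  by rewrite Normc.normcM nz mulr1 normc_real normr_weight_le1.
have h2 : normc ((weight N.+1 1 : R)%:C%C * expe b) <= 1.
  by rewrite Normc.normcM normc_expe mulr1 normc_real normr_weight_le1.
have h3 : normc (\sum_(1 <= n < N.+1)
    ((weight N.+1 n.+1 : R)%:C%C - (weight N.+1 n)%:C%C) * expe b ^+ n.+1)
    <= \sum_(1 <= n < N.+1) 2 / n.+1%:R.
  apply: le_trans (normc_sum _ _ _) _; apply: ler_sum_nat => n /andP[n0 _].
  rewrite Normc.normcM nz mulr1 -rmorphB normc_real; exact: weight_variation.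
have -> : 2 * harmonic_sum N.+1 = 1 + \sum_(1 <= n < N.+1) 2 / n.+1%:R + 1 :> R.
  rewrite /harmonic_sum big_ltn// invr1 mulrDr mulr1 big_add1 /= big_distrr /=; ring.
apply: lerD => //; apply: le_trans (le_normcD _ _) _; exact: lerD.
Qed.

Lemma kernel_le_nat {R : realType} (N : nat) (b : R) : normc (kernel N b) <= N%:R.
Proof.
apply: le_trans (normc_sum _ _ _) _.
apply: (@le_trans _ _ (\sum_(1 <= n < N.+1) 1)); last by rewrite sumr_const_nat subn1.
apply: ler_sum => n _.
by rewrite Normc.normcM normc_expe mulr1 normc_real normr_weight_le1.
Qed.

Lemma kernel_int {R : realType} (N : nat) (b : R) (k : int) :
  kernel N (b + k%:~R) = kernel N b.
Proof.
apply: eq_bigr => n _; congr (_ * _).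
by rewrite !expeM_nat expeD expe_int mulr1.
Qed.

(* The terms with a zero denominator vanish because [0^-1 = 0]; the indicator
   terms take over there. *)
Definition cell_bound {R : realFieldType} (N j : nat) : R :=
  N%:R * ((j == 0)%:R + (j == N.-1)%:R) +
  2 * harmonic_sum N * N%:R * (j%:R^-1 + (N.-1 - j)%:R^-1).

(** In the cell [j] the fractional part is at distance at least [j / N] from 0 and [(N - 1 - j) / N]
    from 1. This fails to help only in the first and last cells, where the trivial bound [N] is
    used. *)
Lemma kernel_le_cell {R : realType} (N j : nat) (b : R) :
  j%:R <= N%:R * (b - (Num.floor b)%:~R) < j.+1%:R ->
  normc (kernel N b) <= cell_bound N j.
Proof.
case: (posnP N) => [->|N0 /andP[]].
  by rewrite mul0r => _; apply: le_trans (kernel_le_nat _ _) _; rewrite /cell_bound mul0r mulr0 mul0r addr0.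
rewrite -(kernel_int N b (- Num.floor b)) mulrNz.
set t := b - _ => h1 h2.
have t0 : 0 <= t by rewrite subr_ge0 floor_le.
have t1 : t < 1 by have := floorD1_gt b; rewrite intrD /t; lra.
have H1 : 1 <= harmonic_sum N :> R by exact: harmonic_sum_ge1.
have Np : 0 < N%:R :> R by rewrite ltr0n.
have jN : (j < N)%N by rewrite -(ltr_nat R); nra.
have pos2 : 0 <= 2 * harmonic_sum N * N%:R * (j%:R^-1 + (N.-1 - j)%:R^-1) :> R.
  by rewrite !mulr_ge0 ?addr_ge0 ?invr_ge0//; lra.
rewrite /cell_bound.
case: eqVneq => [j0|j0].
  apply: le_trans (kernel_le_nat _ _) _; rewrite ler_wpDr// mulrDr mulr1 lerDl mulr_ge0//.
case: eqVneq => [jN'|jN'].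
  by apply: le_trans (kernel_le_nat _ _) _; rewrite ler_wpDr// add0r mulr1.
rewrite addr0 mulr0 add0r.
have j0' : 0 < j%:R :> R by rewrite ltr0n; lia.
set k := (N.-1 - j)%N.
have k0 : 0 < k%:R :> R by rewrite ltr0n; lia.
have Njk : N%:R = j%:R + k%:R + 1 :> R by rewrite -natrD natr1; congr (_ *+ _); lia.
have tj : j%:R / N%:R <= t by rewrite ler_pdivrMr// mulrC.
have tk : k%:R / N%:R <= 1 - t.
  rewrite ler_pdivrMr// mulrBl mul1r lerBrDr [t * _]mulrC; move: h2; rewrite -natr1; lra.
have t0' : 0 < t by apply: lt_le_trans tj; rewrite divr_gt0.
have t01 : 0 < t < 1 by rewrite t0' t1.
have hmin : Num.min (j%:R / N%:R) (k%:R / N%:R) <= normc (1 - expe t).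
  apply: le_trans (normc_1Bexpe_ge t01); rewrite le_min; apply/andP; split; rewrite ge_min.
    by rewrite tj.
  by rewrite tk orbT.
have hK := kernel_le_inv t N0.
have K0 : 0 <= normc (kernel N t).
  by apply: le_trans (normc_ge_normr_Re _); exact: normr_ge0.
have h4 : Num.min (j%:R / N%:R) (k%:R / N%:R) * normc (kernel N t) <= 2 * harmonic_sum N.
  by apply: le_trans hK; rewrite ler_wpM2r.
have ij : 0 < j%:R^-1 :> R by rewrite invr_gt0.
have ik : 0 < k%:R^-1 :> R by rewrite invr_gt0.
(* Whichever quotient is the smaller, its reciprocal occurs in the bound, and the other summand is
   nonnegative. *)
move: h4; rewrite minEle; case: ifP => _ h4.
  have -> : normc (kernel N t) = N%:R * j%:R^-1 * (j%:R / N%:R * normc (kernel N t)).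
    by field; rewrite !gt_eqF.
  apply: le_trans (ler_wpM2l _ h4) _; first by rewrite mulr_ge0// ltW.
  have : 0 <= 2 * harmonic_sum N * N%:R * k%:R^-1 :> R by rewrite !mulr_ge0//; lra.
  by rewrite !mulrDr; lra.
have -> : normc (kernel N t) = N%:R * k%:R^-1 * (k%:R / N%:R * normc (kernel N t)).
  by field; rewrite !gt_eqF.
apply: le_trans (ler_wpM2l _ h4) _; first by rewrite mulr_ge0// ltW.
have : 0 <= 2 * harmonic_sum N * N%:R * j%:R^-1 :> R by rewrite !mulr_ge0//; lra.
by rewrite !mulrDr; lra.
Qed.

(** The end cells give [2N] and the two reciprocal sums give at most [4 N H^2], with [H] the
    harmonic sum; [H >= 1] merges them. *)
Lemma sum_cell_bound {R : realFieldType} (N : nat) : (0 < N)%N ->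
  \sum_(j < N) cell_bound N j <= 6 * N%:R * harmonic_sum N ^+ 2 :> R.
Proof.
case: N => // N _.
have H1 : 1 <= harmonic_sum N.+1 :> R by exact: harmonic_sum_ge1.
have E1 : \sum_(j < N.+1) (j%:R^-1 : R) <= harmonic_sum N.+1.
  rewrite big_ord_recl /= invr0 add0r /harmonic_sum big_add1 /= big_mkord big_ord_recr /=.
  by rewrite lerDl invr_ge0.
have E2 : \sum_(j < N.+1) ((N - j)%:R^-1 : R) = \sum_(j < N.+1) (j%:R^-1 : R).
  rewrite (reindex_inj rev_ord_inj) /=; apply: eq_bigr => j _; congr ((_ *+ _)^-1).
  by have := ltn_ord j; lia.
have D1 : \sum_(j < N.+1) (((j : nat) == 0)%:R : R) = 1.
  rewrite big_ord_recl /= big1 ?addr0// => j _; by rewrite /bump.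
have D2 : \sum_(j < N.+1) (((j : nat) == N)%:R : R) = 1.
  rewrite big_ord_recr /= eqxx big1 ?add0r// => j _.
  by have := ltn_ord j; case: eqVneq => //; lia.
rewrite /cell_bound /= big_split /= -!big_distrr /= !big_split /= D1 D2 E2.
have N0 : 0 < N.+1%:R :> R by rewrite ltr0n.
set H := harmonic_sum N.+1 in H1 E1 *; set S := \sum_(j < _) _ in E1 *.
have h : 2 * H * N.+1%:R * (S + S) <= 2 * H * N.+1%:R * (H + H).
  by rewrite ler_wpM2l ?lerD// !mulr_ge0//; lra.
apply: le_trans (lerD (lexx _) h) _.
rewrite -subr_ge0.
have -> : 6 * N.+1%:R * H ^+ 2 - (N.+1%:R * (1 + 1) + 2 * H * N.+1%:R * (H + H)) =
  2 * N.+1%:R * ((H - 1) * (H + 1)) by ring.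
by rewrite !mulr_ge0//; lra.
Qed.

(** The equation says that [a / p] and [b / q] differ by an integer. Then [p] divides [a q] but not
    [a], hence [p = q]; and [|b - a| < p] forces [k = 0]. *)
Lemma farey_separation (p q a b : nat) (k : int) : prime p -> prime q ->
  (0 < a < p)%N -> (0 < b < q)%N ->
  b%:Z * p%:Z - a%:Z * q%:Z + k * (p%:Z * q%:Z) = 0 -> p = q /\ a = b.
Proof.
move=> pp pq /andP[a0 ap] /andP[b0 bq] e.
have pq_eq : p = q.
  have : (p%:Z %| a%:Z * q%:Z)%Z.
    by apply/dvdzP; exists (b%:Z + k * q%:Z); rewrite -[LHS](addr0) -e; ring.
  rewrite -PoszM dvdzE /= Euclid_dvdM// => /orP[/(dvdn_leq a0)|]; first lia.
  by rewrite dvdn_prime2// => /eqP.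
split=> //; move: e bq; rewrite -pq_eq => e bq.
have p0 : (0 < p%:Z) by have := prime_gt0 pp; lia.
have e2 : p%:Z * (b%:Z - a%:Z + k * p%:Z) = 0 by rewrite -[RHS]e; ring.
move/eqP: e2; rewrite mulf_eq0 gt_eqF//= => /eqP e2.
have k0 : k = 0 by nia.
by move: e2; rewrite k0; lia.
Qed.

(* Distinct fractions of denominators at most [Q] are [1 / Q ^ 2]-separated
   modulo 1, so that each cell [[j / N, (j + 1) / N[] contains at most one of
   the points [alpha - a / p]. *)
Lemma sum_kernel_farey {R : realType} (Q N : nat) (alpha : R) :
  (0 < N)%N -> (Q ^ 2 <= N)%N ->
  \sum_(i : 'I_Q.+1 * 'I_Q.+1 | prime i.1 && (0 < i.2 < i.1)%N)
     normc (kernel N (alpha - i.2%:R / i.1%:R)) <= 6 * N%:R * harmonic_sum N ^+ 2.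
Proof.
case: N => // N _ QN; apply: le_trans (sum_cell_bound _); last by [].
pose beta (i : 'I_Q.+1 * 'I_Q.+1) : R := alpha - i.2%:R / i.1%:R.
pose fr (x : R) := x - (Num.floor x)%:~R.
pose cell i := Num.truncn (N.+1%:R * fr (beta i)).
have Np : 0 < N.+1%:R :> R by rewrite ltr0n.
have fr_ge0 x : 0 <= fr x by rewrite subr_ge0 floor_le.
have fr_lt1 x : fr x < 1 by have := floorD1_gt x; rewrite intrD /fr; lra.
have cellP i : (cell i)%:R <= N.+1%:R * fr (beta i) < (cell i).+1%:R.
  by rewrite truncnS_gt andbT truncn_le// mulr_ge0.
have cell_lt i : (cell i < N.+1)%N.
  rewrite -(ltr_nat R); case/andP: (cellP i) => h _; apply: le_lt_trans h _.
  by rewrite -[X in _ < X]mulr1 ltr_pM2l.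
pose f i : 'I_N.+1 := Ordinal (cell_lt i).
pose A := [set i : 'I_Q.+1 * 'I_Q.+1 | prime i.1 && (0 < i.2 < i.1)%N]%SET.
have injf : {in A &, injective f}.
  move=> [p a] [q b]; rewrite !inE /= => /andP[pp ap] /andP[pq bq] /(congr1 val) /= cc.
  have := cellP (p, a); have := cellP (q, b); rewrite -cc.
  set c := cell _ => /andP[h1 h2] /andP[h3 h4].
  (* The integer [z] is [p q] times the difference of the two fractional parts. These share a cell
     of length [1 / N] and [p q <= Q^2 <= N], so [|z| < 1] and [z = 0]. *)
  set k := Num.floor (beta (q, b)) - Num.floor (beta (p, a)).
  set z := b%:Z * p%:Z - a%:Z * q%:Z + k * (p%:Z * q%:Z).
  have p0 : 0 < p%:R :> R by rewrite ltr0n prime_gt0.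
  have q0 : 0 < q%:R :> R by rewrite ltr0n prime_gt0.
  have zE : z%:~R = (p%:R * q%:R) * (fr (beta (p, a)) - fr (beta (q, b))) :> R.
    rewrite /z /k /fr /beta /= !(intrD, intrM, mulrNz) -!pmulrn.
    by field; rewrite !gt_eqF.
  have d1 : `|N.+1%:R * (fr (beta (p, a)) - fr (beta (q, b)))| < 1.
    by rewrite mulrBr ltr_norml; move: h1 h2 h3 h4; rewrite -!natr1; lra.
  have pqN : p%:R * q%:R <= N.+1%:R :> R.
    rewrite -natrM ler_nat; apply: leq_trans QN; rewrite -mulnn leq_mul//.
      by have := ltn_ord p.
    by have := ltn_ord q.
  have z0 : z = 0.
    apply/eqP; rewrite -normr_eq0 -[_ == _]negbK; apply/negP => zn.
    have : 1 <= `|z|%:~R :> R by rewrite -[1]/(1%:~R) ler_int; move: zn; lia.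
    rewrite intr_norm zE normrM (ger0_norm (mulr_ge0 (ltW p0) (ltW q0))) => h.
    have : `|N.+1%:R * (fr (beta (p, a)) - fr (beta (q, b)))| >= 1.
      by rewrite normrM (ger0_norm (ltW Np)); apply: le_trans h _; rewrite ler_wpM2r.
    by rewrite leNgt d1.
  have [e1 e2] := farey_separation pp pq ap bq z0.
  by congr (_, _); apply: val_inj.
rewrite -[X in X <= _](eq_bigl _ _ (finset.in_set _)) -/A.
apply: (@le_trans _ _ (\sum_(i in A) cell_bound N.+1 (f i))).
  by apply: ler_sum => i _; apply: kernel_le_cell; exact: cellP.
(* By injectivity the sum runs over distinct cells, and nonnegativity allows it to be extended to
   all cells. *)
rewrite -(big_imset (cell_bound N.+1 \o val) injf) /=.
rewrite big_mkcond /=; apply: ler_sum => j _; case: ifP => // _.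
have H1 : 1 <= harmonic_sum N.+1 :> R by exact: harmonic_sum_ge1.
rewrite /cell_bound addr_ge0// !mulr_ge0// ?addr_ge0 ?invr_ge0//; lra.
Qed.

(** * Correlation of the weight with the Liouville function *)

Lemma sum_vanishing_tail {R : nmodType} (N M : nat) (F : nat -> R) : (N <= M)%N ->
  (forall k, (N < k)%N -> F k = 0) ->
  \sum_(1 <= k < M.+1) F k = \sum_(1 <= k < N.+1) F k.
Proof.
move=> NM F0; rewrite (big_cat_nat (n := N.+1))//= [X in _ + X]big_nat_cond.
by rewrite [X in _ + X]big1 ?addr0// => k /andP[/andP[Nk _] _]; exact: F0.
Qed.

Lemma sum_nat_indicator {R : pzRingType} (N k : nat) (F : nat -> R) :
  \sum_(1 <= d < N.+1) (k == d)%:R * F d = ((0 < k <= N)%N)%:R * F k.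
Proof.
case: (boolP (0 < k <= N)%N) => hk.
  rewrite (bigD1_seq k) ?mem_index_iota ?iota_uniq//= eqxx big1 ?addr0// => d.
  by rewrite eq_sym => /negbTE->; rewrite mul0r.
rewrite mul0r big_nat_cond big1// => d /andP[hd _].
by case: eqP => [e|]; [move: hk; rewrite e => /negP; lia | rewrite mul0r].
Qed.

(** Grouping by [k = d m] produces the divisor sum of [liouville], the indicator of the squares. The
    vanishing of [g] beyond [N] makes the box of pairs [(m, d)] and the range [k <= N] carry the
    same sum. *)
Lemma sum_liouville_convolution {R : realFieldType} (N : nat) (g : nat -> R) :
  (forall k, (N < k)%N -> g k = 0) ->
  \sum_(1 <= m < N.+1) \sum_(1 <= d < N.+1) (liouville m)%:~R * g (d * m)%N =
  \sum_(1 <= j < N.+1) g (j * j)%N.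
Proof.
move=> g0.
transitivity (\sum_(1 <= k < N.+1) g k * (\sum_(m <- divisors k) liouville m)%:~R).
  transitivity (\sum_(1 <= m < N.+1) \sum_(1 <= d < N.+1) \sum_(1 <= k < N.+1)
     ((d * m)%N == k)%:R * ((liouville m)%:~R * g k)).
    apply: eq_big_nat => m /andP[m0 _]; apply: eq_big_nat => d /andP[d0 _].
    rewrite sum_nat_indicator muln_gt0 m0 d0 /=.
    by case: leqP => h; rewrite ?mul1r// mul0r g0// mulr0.
  transitivity (\sum_(1 <= m < N.+1) \sum_(1 <= k < N.+1) \sum_(1 <= d < N.+1)
     ((d * m)%N == k)%:R * ((liouville m)%:~R * g k)).
    by apply: eq_bigr => m _; rewrite exchange_big.
  rewrite exchange_big /=; apply: eq_big_nat => k /andP[k0 kN].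
  rewrite rmorph_sum /= big_distrr /= [RHS](bigID (fun m => (0 < m <= N)%N)) /=.
  rewrite [X in _ = _ + X]big1_seq ?addr0; last first.
    move=> m /andP[hm]; rewrite -dvdn_divisors// => mk; case/negP: hm.
    by rewrite (dvdn_gt0 k0 mk) (leq_trans (dvdn_leq k0 mk)).
  rewrite (bigID (fun m => m %| k)%N) /= [X in _ + X = _]big1_seq ?addr0; last first.
    move=> m /andP[mk _]; apply: big1 => d _.
    by case: eqP => [e|]; [case/negP: mk; rewrite -e dvdn_mull | rewrite mul0r].
  transitivity (\sum_(m <- [seq m <- index_iota 1 N.+1 | (m %| k)%N]) g k * (liouville m)%:~R).
    rewrite big_filter big_nat_cond [RHS]big_nat_cond; apply: eq_bigr.
    move=> m /andP[/andP[m0 mN] /dvdnP[e ke]].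
    rewrite -big_distrl /=.
    have e0 : (0 < e <= N)%N by rewrite ke in k0 kN; nia.
    suff -> : \sum_(1 <= d < N.+1) ((d * m)%N == k)%:R = 1 :> R by rewrite mul1r mulrC.
    transitivity (\sum_(1 <= d < N.+1) (e == d)%:R * (1 : R)).
      apply: eq_bigr => d _; rewrite mulr1 ke eqn_pmul2r//.
      by rewrite eq_sym.
    by rewrite sum_nat_indicator e0 mulr1.
  rewrite -[RHS]big_filter; apply: perm_big; apply: uniq_perm.
  - by rewrite filter_uniq// iota_uniq.
  - by rewrite filter_uniq// divisors_uniq.
  by move=> m; rewrite !mem_filter mem_index_iota -dvdn_divisors// andbC ltnS.
transitivity (\sum_(1 <= k < N.+1) \sum_(1 <= j < N.+1) ((j * j)%N == k)%:R * g k).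
  apply: eq_big_nat => k /andP[k0 kN]; rewrite sum_liouville_divisors//.
  case: asboolP => [[j e]|h]; last first.
    rewrite mulr0 big1// => j _.
    by case: eqP => [e|]; [case: h; exists j | rewrite mul0r].
  rewrite mulr1 e in k0 kN *; transitivity (\sum_(1 <= i < N.+1) (j == i)%:R * g (j * j)%N).
    have jN : (0 < j <= N)%N by apply/andP; split; nia.
    by rewrite sum_nat_indicator jN mul1r.
  apply: eq_bigr => i _; congr ((nat_of_bool _)%:R * _).
  by apply/eqP/eqP => [->//|]; nia.
rewrite exchange_big /=; apply: eq_big_nat => j /andP[j0 jN].
rewrite sum_nat_indicator muln_gt0 j0 /=.
by case: leqP => h; rewrite ?mul1r// mul0r g0.
Qed.

Lemma alternating_sum_vanishing_tail {R : comPzRingType} (N : nat) (F : nat -> R) :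
  (forall k, (N < k)%N -> F k = 0) ->
  - \sum_(1 <= d < N.+1) (-1) ^+ d * F d =
  \sum_(1 <= d < N.+1) F d - 2 * \sum_(1 <= d < N.+1) F (2 * d)%N.
Proof.
move=> F0.
(* Up to [2N] the even indices are exactly the [2d] with [d <= N], so the identity holds for
   arbitrary [F] by induction. *)
rewrite -(@sum_vanishing_tail _ N N.*2 F)//; last by lia.
rewrite -(@sum_vanishing_tail _ N N.*2 (fun d => (-1) ^+ d * F d)); last first.
- by move=> k hk; rewrite F0// mulr0.
- lia.
elim: N {F0} => [|N IH]; first by rewrite double0 !big_geq//; ring.
rewrite doubleS !(big_nat_recr N.*2.+2)//= !(big_nat_recr N.*2.+1)//= (big_nat_recr N.+1)//=.
rewrite !opprD IH !exprS -mul2n exprM sqrrN expr1n expr1n.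
have -> : (2 * N.+1 = (2 * N).+2)%N by lia.
ring.
Qed.

Lemma sum_squares (R : realFieldType) (M : nat) :
  6 * \sum_(1 <= j < M.+1) (j * j)%:R = M%:R * (M%:R + 1) * (2 * M%:R + 1) :> R.
Proof.
elim: M => [|M IH]; first by rewrite big_geq//; ring.
rewrite big_nat_recr//= mulrDr IH natrM -natr1; ring.
Qed.

(** The main term is the integral of [1 - t^2 / y] over [[0, sqrt y]]. With [M = floor(sqrt y)] the
    sum is evaluated exactly, and the bounds become polynomial inequalities in [M] and the
    fractional part of [sqrt y]. *)
Lemma sum_hat_squares {R : realType} (y : R) (J : nat) : 0 < y -> y <= (J * J)%:R ->
  2 / 3 * Num.sqrt y - 1 <= \sum_(1 <= j < J.+1) hat ((j * j)%:R / y) <= 2 / 3 * Num.sqrt y.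
Proof.
move=> y0 yJ; set s := Num.sqrt y.
have s0 : 0 < s by rewrite sqrtr_gt0.
have sy : y = s * s by rewrite -expr2 sqr_sqrtr// ltW.
set M := Num.truncn s.
have Ms : M%:R <= s by rewrite truncn_le// ltW.
have sM : s < M%:R + 1 by rewrite natr1; exact: truncnS_gt.
have MJ : (M <= J)%N.
  rewrite -(ler_nat R); apply: le_trans Ms _.
  by move: yJ; rewrite sy natrM => h; have : 0 <= J%:R :> R by []; nra.
have M0 : 0 <= M%:R :> R by [].
rewrite (@sum_vanishing_tail _ M J (fun j => hat ((j * j)%:R / y)))//; last first.
  move=> j Mj; apply: hat_large; rewrite ler_pdivlMr// mul1r sy natrM.
  have : M%:R + 1 <= j%:R :> R by rewrite natr1 ler_nat.
  by nra.
have -> : \sum_(1 <= j < M.+1) hat ((j * j)%:R / y) =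
    M%:R - M%:R * (M%:R + 1) * (2 * M%:R + 1) / (6 * y) :> R.
  rewrite -sum_squares.
  transitivity (\sum_(1 <= j < M.+1) (1 - (j * j)%:R / y : R)).
    apply: eq_big_nat => j /andP[_ jM]; apply: hat_small.
    rewrite ler_pdivrMr// mul1r sy natrM.
    have : j%:R <= M%:R :> R by rewrite ler_nat.
    by have : 0 <= j%:R :> R by []; nra.
  rewrite sumrB sumr_const_nat subn1 /= -big_distrl /=; field; rewrite gt_eqF//.
(* Of the integrality of [M] only the dichotomy [M01] is kept; it yields [3 m^2 - m >= 0] below. *)
have y6 : 0 < 6 * y by rewrite mulr_gt0.
have M01 : M%:R = 0 :> R \/ 1 <= M%:R :> R.
  by case: (posnP M) => [->|M1]; [left | right; rewrite ler1n].
move: M%:R M0 Ms sM M01 => m m0 ms sm m01.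
have K : m * (m + 1) * (2 * m + 1) / (6 * y) * (6 * y) = m * (m + 1) * (2 * m + 1).
  by rewrite divfK// gt_eqF.
move: K; set q := m * (m + 1) * (2 * m + 1) / (6 * y) => K; clearbody q.
set t := s - m; have t0 : 0 <= t by rewrite /t; lra.
have t1 : t <= 1 by rewrite /t; lra.
have sE : s = m + t by rewrite /t; ring.
rewrite sy sE in K y6 *.
apply/andP; split.
  rewrite -(ler_pM2r y6) !mulrBl K -subr_ge0.
  have -> : m * (6 * ((m + t) * (m + t))) - m * (m + 1) * (2 * m + 1)
    - (2 / 3 * (m + t) * (6 * ((m + t) * (m + t))) - 1 * (6 * ((m + t) * (m + t)))) =
    3 * m * m - m + 6 * m * t * (2 - t) + 6 * t * t - 4 * t * t * t by field.
  have h1 : 0 <= m * t * (2 - t) by rewrite !mulr_ge0//; lra.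
  have h2 : 0 <= t * t * (1 - t) by rewrite !mulr_ge0//; lra.
  have h3 : 0 <= t * t by rewrite mulr_ge0.
  suff : 0 <= 3 * m * m - m by nra.
  by case: m01 => [->|m1]; [lra | nra].
rewrite -(ler_pM2r y6) mulrBl K -subr_ge0.
have -> : 2 / 3 * (m + t) * (6 * ((m + t) * (m + t))) -
   (m * (6 * ((m + t) * (m + t))) - m * (m + 1) * (2 * m + 1)) =
   2 * t * t * (3 * m + 2 * t) + 3 * m * m + m by field.
by rewrite !addr_ge0// !mulr_ge0//; lra.
Qed.

(** Splitting the alternating sum and applying the convolution identity at the scales [y = N / p]
    and [y / 2] leaves two sums over squares. Their main terms combine to
    [(2/3)(1 - sqrt 2) sqrt y], which is negative. *)
Lemma weight_correlation_le {R : realType} (N p : nat) : (0 < p)%N ->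
  (900 * p <= N)%N ->
  \sum_(1 <= m < N.+1) (liouville m)%:~R * weight N (p * m) <=
    - (1 / 5) * Num.sqrt (N%:R / p%:R) :> R.
Proof.
move=> p0 pN; set y := N%:R / p%:R.
have pR : 0 < p%:R :> R by rewrite ltr0n.
have y900 : 900 <= y by rewrite ler_pdivlMr// -natrM ler_nat.
have y0 : 0 < y by lra.
have yN : y <= N%:R by rewrite ler_pdivrMr// ler_peMr// ler1n.
have g0 k : (N < k)%N -> hat (k%:R / y) = 0.
  move=> Nk; apply: hat_large; rewrite ler_pdivlMr// mul1r; apply: le_trans yN _.
  by rewrite ler_nat ltnW.
have g20 k : (N < k)%N -> hat (k%:R / (y / 2)) = 0.
  move=> Nk; apply: hat_large; rewrite ler_pdivlMr; last by lra.
  rewrite mul1r.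
  have : N%:R <= k%:R :> R by rewrite ler_nat ltnW.
  lra.
have -> : \sum_(1 <= m < N.+1) (liouville m)%:~R * weight N (p * m) =
   \sum_(1 <= j < N.+1) hat ((j * j)%:R / y)
   - 2 * \sum_(1 <= j < N.+1) hat ((j * j)%:R / (y / 2)) :> R.
  rewrite -(sum_liouville_convolution g0) -(sum_liouville_convolution g20).
  rewrite big_distrr /= -sumrB; apply: eq_big_nat => m /andP[m0 _].
  rewrite -!big_distrr /= mulrCA -mulrBr; congr (_ * _).
  rewrite /weight; pose F d : R := hat ((d * m)%:R / y).
  have -> : \sum_(1 <= d < N.+1) (-1) ^+ d * hat (d%:R * (p * m)%:R / N%:R) =
     \sum_(1 <= d < N.+1) (-1) ^+ d * F d.
    apply: eq_bigr => d _; congr (_ * hat _); rewrite /y !natrM.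
    by field; rewrite !gt_eqF//; move: yN; lra.
  rewrite alternating_sum_vanishing_tail; last first.
    by move=> k Nk; apply: g0; nia.
  congr (_ - 2 * _); apply: eq_bigr => d _; rewrite /F; congr hat.
  by rewrite !natrM; field; rewrite gt_eqF.
have NN : N%:R <= (N * N)%:R :> R by rewrite ler_nat; nia.
have /andP[_ h1] := sum_hat_squares y0 (le_trans yN NN).
have y20 : 0 < y / 2 by lra.
have y2N : y / 2 <= (N * N)%:R by lra.
have /andP[h2 _] := sum_hat_squares y20 y2N.
set s := Num.sqrt y in h1 *; set r := Num.sqrt (y / 2) in h2 *.
have sy : s * s = y by rewrite -expr2 sqr_sqrtr// ltW.
have ry : r * r = y / 2 by rewrite -expr2 sqr_sqrtr// ltW.
have s0 : 0 <= s by exact: sqrtr_ge0.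
have r0 : 0 <= r by exact: sqrtr_ge0.
(* The sum is at most [(2/3) s - (4/3) r + 2]. With [r >= (7/10) s] this is [-(4/15) s + 2], below
   [-s / 5] as soon as [s >= 30]; hence the 900. *)
have s30 : 30 <= s by nra.
have rs : 7 / 10 * s <= r by nra.
lra.
Qed.

(** Substitute [n = p m], which flips the sign of [liouville]. The extra terms with [p m > N] have
    weight 0, every hat in them being at an argument at least 1. *)
Lemma sum_liouville_multiples {R : realType} (N p : nat) : prime p ->
  \sum_(1 <= n < N.+1) (liouville n)%:~R * weight N n * (p %| n)%:R =
  - \sum_(1 <= m < N.+1) (liouville m)%:~R * weight N (p * m) :> R.
Proof.
move=> pp; have p0 := prime_gt0 pp.
transitivity (\sum_(1 <= n < N.+1) \sum_(1 <= m < N.+1)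
    ((p * m)%N == n)%:R * ((liouville n)%:~R * weight N n : R)).
  apply: eq_big_nat => n /andP[n0 nN]; rewrite -big_distrl /= mulrC; congr (_ * _).
  case: (boolP (p %| n)%N) => [/dvdnP[k nk]|pn]; last first.
    rewrite big1// => m _; case: eqP => // e; case/negP: pn.
    by rewrite -e dvdn_mulr.
  have hk : (0 < k <= N)%N by rewrite nk in n0 nN; apply/andP; split; nia.
  transitivity (\sum_(1 <= m < N.+1) (k == m)%:R * (1 : R)).
    by rewrite sum_nat_indicator hk mulr1.
  apply: eq_bigr => m _; rewrite mulr1 nk mulnC eqn_pmul2r//.
  by rewrite eq_sym.
rewrite exchange_big /= -sumrN; apply: eq_big_nat => m /andP[m0 mN].
rewrite sum_nat_indicator muln_gt0 p0 m0 /=.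
case: leqP => h.
  by rewrite mul1r liouvilleM// liouville_prime// mulN1r rmorphN mulNr.
rewrite mul0r [weight _ _](_ : _ = 0) ?mulr0 ?oppr0//.
rewrite /weight big_nat_cond big1 ?oppr0// => d /andP[/andP[d0 _] _].
rewrite hat_large ?mulr0// ler_pdivlMr ?ltr0n; last by lia.
by rewrite mul1r -natrM ler_nat; nia.
Qed.

(** The factor is the Ramanujan sum of modulus [p]. Its two parts contribute with the same sign: the
    multiples of [p] give the bound, and the part from [-1] is nonnegative. *)
Lemma ramanujan_correlation_ge {R : realType} (N p : nat) : prime p ->
  (900 * p <= N)%N ->
  1 / 5 * (Num.sqrt p%:R * Num.sqrt N%:R) <=
  \sum_(1 <= n < N.+1) (liouville n)%:~R * weight N n * (p%:R * (p %| n)%:R - 1) :> R.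
Proof.
move=> pp pN; have p0 := prime_gt0 pp.
have pR : 0 < p%:R :> R by rewrite ltr0n.
have -> : \sum_(1 <= n < N.+1) (liouville n)%:~R * weight N n * (p%:R * (p %| n)%:R - 1) =
   p%:R * (\sum_(1 <= n < N.+1) (liouville n)%:~R * weight N n * (p %| n)%:R) -
   \sum_(1 <= n < N.+1) (liouville n)%:~R * weight N (1 * n) :> R.
  rewrite big_distrr /= -sumrB; apply: eq_bigr => n _; rewrite mul1n; ring.
rewrite sum_liouville_multiples//.
have h1 := @weight_correlation_le R N p p0 pN.
have h2 := @weight_correlation_le R N 1 isT (leq_trans (leq_mul (leqnn _) p0) pN).
rewrite divr1 in h2.
have e : p%:R * Num.sqrt (N%:R / p%:R) = Num.sqrt p%:R * Num.sqrt N%:R :> R.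
  rewrite sqrtrM// sqrtrV// mulrCA mulrA -{1}(@sqr_sqrtr _ p%:R)// expr2.
  by field; rewrite sqrtr_eq0 -ltNge.
have h3 : 0 <= Num.sqrt N%:R :> R by exact: sqrtr_ge0.
rewrite -e; nra.
Qed.

(** * Integration against the kernel *)

Lemma Re_expe {R : realType} (x : R) : complex.Re (expe x) = cos (2 * pi * x).
Proof. by []. Qed.

Lemma sinDint {R : realType} (x : R) (k : int) :
  sin (2 * pi * (x + k%:~R)) = sin (2 * pi * x).
Proof. by have /(congr1 (@complex.Im R)) := expeD x k%:~R; rewrite expe_int mulr1. Qed.

Lemma continuous_sumr {R : realType} (I : Type) (s : seq I) (F : I -> R -> R) :
  (forall i, continuous (F i)) -> continuous (fun x => \sum_(i <- s) F i x).
Proof.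
move=> cF; elim: s => [|j s IH] x.
  under eq_fun do rewrite big_nil; exact: cvg_cst.
under eq_fun do rewrite big_cons; apply: cvgD; [exact: cF | exact: IH].
Qed.

Lemma continuous_integrable01 {R : realType} (f : R -> R) : continuous f ->
  lebesgue_measure.-integrable `[0, 1]%classic (EFin \o f).
Proof.
move=> cf; apply: continuous_compact_integrable; first exact: segment_compact.
exact: continuous_subspaceT.
Qed.

Lemma Rintegral_sum_continuous {R : realType} (I : Type) (s : seq I) (F : I -> R -> R) :
  (forall i, continuous (F i)) ->
  \int[lebesgue_measure]_(x in `[0, 1]) (\sum_(i <- s) F i x) =
  \sum_(i <- s) \int[lebesgue_measure]_(x in `[0, 1]) F i x.
Proof.
move=> cF.
elim: s => [|i s IH].
  under eq_Rintegral do rewrite big_nil.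
  by rewrite big_nil Rintegral_cst// mul0r.
under eq_Rintegral do rewrite big_cons.
rewrite big_cons -IH RintegralD//; apply: continuous_integrable01; first exact: cF.
exact: continuous_sumr.
Qed.

Lemma continuous_cos_affine {R : realType} (k b : R) :
  continuous (fun x : R => cos (2 * pi * (k * x + b))).
Proof.
move=> x; apply: (@continuous_comp _ _ _ (fun x : R => 2 * pi * (k * x + b)) cos).
  apply: cvgM; first exact: cvg_cst.
  apply: cvgD; last exact: cvg_cst.
  apply: cvgM; [exact: cvg_cst | exact: cvg_id].
exact: continuous_cos.
Qed.

(** Orthogonality of the characters in real form. The shift [b] carries the translation of the
    kernel. *)
Lemma Rintegral_cos_affine {R : realType} (k : int) (b : R) :
  \int[lebesgue_measure]_(x in `[0, 1]) cos (2 * pi * (k%:~R * x + b)) =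
  (k == 0)%:R * cos (2 * pi * b).
Proof.
have [->|k0] := eqVneq k 0.
  under eq_Rintegral do rewrite mul0r add0r.
  rewrite Rintegral_cst// [fine _](_ : _ = 1) ?mulr1 ?mul1r//.
  have := @lebesgue_measure_itv R `[0, 1]; rewrite /= lte_fin ltr01 oppr0 adde0.
  by move/(congr1 fine).
rewrite mul0r.
have pi0 := pi_gt0 R.
have kR : k%:~R != 0 :> R by rewrite intr_eq0.
pose F (x : R) : R^o := sin (2 * pi * (k%:~R * x + b)) / (2 * pi * k%:~R).
have dF (x : R) : is_derive x 1 F (cos (2 * pi * (k%:~R * x + b))).
  rewrite /F; apply: is_derive_eq.
  have := gt_eqF pi0; rewrite /GRing.scale /=; move: (pi : R) => q q0.
  by field; rewrite kR q0.
rewrite /Rintegral (@continuous_FTC2 _ _ F).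
- rewrite /= /F mulr1 mulr0 add0r [k%:~R + b]addrC sinDint subrr//.
- exact: ltr01.
- exact/continuous_subspaceT/continuous_cos_affine.
- split.
  + by move=> x _; exact: ex_derive.
  + apply: cvg_at_right_filter; apply: differentiable_continuous; apply/derivable1_diffP.
    exact: ex_derive.
  + apply: cvg_at_left_filter; apply: differentiable_continuous; apply/derivable1_diffP.
    exact: ex_derive.
- by move=> x _; rewrite derive1E; exact: derive_val.
Qed.

Lemma Re_sum (R : rcfType) (I : Type) (s : seq I) (F : I -> R[i]) :
  complex.Re (\sum_(i <- s) F i) = \sum_(i <- s) complex.Re (F i).
Proof. by apply: big_morph => //; case=> a b [c d]. Qed.

Lemma Im_sum (R : rcfType) (I : Type) (s : seq I) (F : I -> R[i]) :
  complex.Im (\sum_(i <- s) F i) = \sum_(i <- s) complex.Im (F i).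
Proof. by apply: big_morph => //; case=> a b [c d]. Qed.

Lemma Re_realM (R : rcfType) (a : R) (z : R[i]) : complex.Re (a%:C%C * z) = a * complex.Re z.
Proof. by case: z => x y /=; rewrite mul0r subr0. Qed.

Lemma Im_realM (R : rcfType) (a : R) (z : R[i]) : complex.Im (a%:C%C * z) = a * complex.Im z.
Proof. by case: z => x y /=; rewrite mul0r addr0. Qed.

Lemma intr_real_complex (R : rcfType) (k : int) : (k%:~R : R[i]) = ((k%:~R : R)%:C)%C.
Proof. by rewrite rmorph_int. Qed.

Lemma continuous_normc_liouville_sum {R : realType} (X : R) :
  continuous (fun a : R => normc (liouville_sum X a)).
Proof.
pose f (a : R) : R := \sum_(1 <= n < (Num.truncn X).+1) (liouville n)%:~R * cos (2 * pi * (n%:R * a)).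
pose g (a : R) : R := \sum_(1 <= n < (Num.truncn X).+1) (liouville n)%:~R * sin (2 * pi * (n%:R * a)).
have -> : (fun a : R => normc (liouville_sum X a)) = (fun a : R => Num.sqrt (f a ^+ 2 + g a ^+ 2)).
  apply/funext => a.
  have -> z : normc z = Num.sqrt (complex.Re z ^+ 2 + complex.Im z ^+ 2) :> R by case: z.
  rewrite /liouville_sum Re_sum Im_sum; congr (Num.sqrt (_ ^+ 2 + _ ^+ 2)); apply: eq_bigr => n _.
    by rewrite intr_real_complex Re_realM.
  by rewrite intr_real_complex Im_realM.
have lin (n : nat) : continuous (fun a : R => 2 * pi * (n%:R * a)).
  move=> a; do 2 (apply: cvgM; first exact: cvg_cst); exact: cvg_id.
have ccos (n : nat) : continuous (fun a : R => cos (2 * pi * (n%:R * a))).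
  move=> a; apply: (@continuous_comp _ _ _ (fun a : R => 2 * pi * (n%:R * a)) cos).
    exact: lin.
  exact: continuous_cos.
have csin (n : nat) : continuous (fun a : R => sin (2 * pi * (n%:R * a))).
  move=> a; apply: (@continuous_comp _ _ _ (fun a : R => 2 * pi * (n%:R * a)) sin).
    exact: lin.
  exact: continuous_sin.
have cf : continuous f.
  by apply: continuous_sumr => n x; apply: cvgM; [exact: cvg_cst | exact: ccos].
have cg : continuous g.
  by apply: continuous_sumr => n x; apply: cvgM; [exact: cvg_cst | exact: csin].
move=> a.
apply: (@continuous_comp _ _ _ (fun x => f x ^+ 2 + g x ^+ 2) Num.sqrt); last exact: sqrt_continuous.
by apply: cvgD; apply: cvgM; [exact: cf | exact: cf | exact: cg | exact: cg].
Qed.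

(** The minus sign in [- a - r] turns the frequencies of the product into differences [n - m].
    Taking real parts keeps the integrals real. *)
Lemma Re_liouville_sum_kernel {R : realType} (X r a : R) (N : nat) :
  complex.Re (liouville_sum X a * kernel N (- a - r)) =
  \sum_(1 <= n < (Num.truncn X).+1) \sum_(1 <= m < N.+1)
    (liouville n)%:~R * weight N m *
      cos (2 * pi * ((n%:Z - m%:Z)%:~R * a + - (m%:R * r))).
Proof.
rewrite /liouville_sum /kernel big_distrl /= Re_sum; apply: eq_bigr => n _.
rewrite big_distrr /= Re_sum; apply: eq_bigr => m _.
rewrite intr_real_complex mulrACA -expeD -rmorphM Re_realM Re_expe.
congr (_ * cos (_ * _)); rewrite intrD mulrNz -!pmulrn; ring.
Qed.

Lemma continuous_Re_liouville_sum_kernel {R : realType} (X r : R) (N : nat) :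
  continuous (fun a : R => complex.Re (liouville_sum X a * kernel N (- a - r))).
Proof.
under eq_fun do rewrite Re_liouville_sum_kernel.
apply: continuous_sumr => n; apply: continuous_sumr => m a.
apply: cvgM; first exact: cvg_cst.
exact: continuous_cos_affine.
Qed.

(** Only the diagonal [n = m] survives integration, and [N <= truncn X] ensures that every [m <= N]
    is met. *)
Lemma Rintegral_liouville_sum_kernel {R : realType} (X r : R) (N : nat) :
  (N <= Num.truncn X)%N ->
  \int[lebesgue_measure]_(a in `[0, 1])
     complex.Re (liouville_sum X a * kernel N (- a - r)) =
  \sum_(1 <= n < N.+1) (liouville n)%:~R * weight N n * cos (2 * pi * (n%:R * r)).
Proof.
move=> NX.
have cc n m (c : R) : continuous (fun a : R => c *
    cos (2 * pi * ((n%:Z - m%:Z)%:~R * a + - (m%:R * r)))).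
  move=> a; apply: cvgM; first exact: cvg_cst.
  exact: continuous_cos_affine.
under eq_Rintegral do rewrite Re_liouville_sum_kernel.
rewrite Rintegral_sum_continuous; last first.
  by move=> n; apply: continuous_sumr => m; exact: cc.
transitivity (\sum_(1 <= n < (Num.truncn X).+1) \sum_(1 <= m < N.+1)
   (n == m)%:R * ((liouville n)%:~R * weight N m * cos (2 * pi * (m%:R * r)))).
  apply: eq_bigr => n _; rewrite Rintegral_sum_continuous; last by move=> m; exact: cc.
  apply: eq_bigr => m _; rewrite RintegralZl//; last first.
    exact/continuous_integrable01/continuous_cos_affine.
  rewrite Rintegral_cos_affine mulrCA; congr (_%:R * (_ * _)); last by rewrite mulrN cosN.
  by rewrite subr_eq0 eqz_nat.
rewrite exchange_big /=; apply: eq_big_nat => m /andP[m0 mN].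
transitivity (\sum_(1 <= n < (Num.truncn X).+1) (m == n)%:R *
   ((liouville n)%:~R * weight N m * cos (2 * pi * (m%:R * r)))).
  by apply: eq_bigr => n _; rewrite eq_sym.
by rewrite sum_nat_indicator m0 (leq_trans _ NX) ?mul1r.
Qed.

(** The finite sum is moved inside the integral; pointwise, each real part is at most the product of
    the moduli, and the kernels are summed at [- a]. *)
Lemma sum_farey_le_Rintegral {R : realType} (X : R) (N Q : nat) :
  (0 < N)%N -> (N <= Num.truncn X)%N -> (Q ^ 2 <= N)%N ->
  \sum_(i : 'I_Q.+1 * 'I_Q.+1 | prime i.1 && (0 < i.2 < i.1)%N)
    \sum_(1 <= n < N.+1) (liouville n)%:~R * weight N n * cos (2 * pi * (n%:R * (i.2%:R / i.1%:R)))
  <= 6 * N%:R * harmonic_sum N ^+ 2 *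
     \int[lebesgue_measure]_(a in `[0, 1]) normc (liouville_sum X a).
Proof.
move=> N0 NX QN.
rewrite -RintegralZl//; last exact/continuous_integrable01/continuous_normc_liouville_sum.
under eq_bigr do rewrite -(Rintegral_liouville_sum_kernel _ NX).
rewrite -big_filter -Rintegral_sum_continuous; last first.
  by move=> i; exact: continuous_Re_liouville_sum_kernel.
apply: le_Rintegral => //.
- apply: continuous_integrable01; apply: continuous_sumr => i.
  exact: continuous_Re_liouville_sum_kernel.
- apply: continuous_integrable01 => a; apply: cvgM; first exact: cvg_cst.
  exact: continuous_normc_liouville_sum.
move=> a _; rewrite big_filter mulrC.
apply: le_trans (ler_wpM2l _ (sum_kernel_farey (- a) N0 QN)); last first.
  exact: le_trans (normr_ge0 _) (normc_ge_normr_Re _).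
rewrite big_distrr /=; apply: ler_sum => i _.
rewrite -Normc.normcM; apply: le_trans (ler_norm _) _; exact: normc_ge_normr_Re.
Qed.

(** * The lower bound *)

Lemma expe_frac_neq1 {R : realType} (n p : nat) : (0 < p)%N -> ~~ (p %| n)%N ->
  expe (n%:R / p%:R : R) != 1.
Proof.
move=> p0 pn; have pR : 0 < p%:R :> R by rewrite ltr0n.
set b := (n %% p)%N.
have b0 : (0 < b)%N by rewrite lt0n; exact: pn.
have bp : (b < p)%N by rewrite ltn_pmod.
have -> : n%:R / p%:R = b%:R / p%:R + (n %/ p)%:R :> R.
  by rewrite {1}(divn_eq n p) -/b natrD natrM; field; rewrite gt_eqF.
rewrite expeD expe_nat mulr1; apply/negP => /eqP e.
set t : R := b%:R / p%:R in e *.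
have t0 : 0 < t by rewrite divr_gt0// ltr0n.
have t1 : t < 1 by rewrite ltr_pdivrMr// mul1r ltr_nat.
have := @normc_1Bexpe_ge R t; rewrite t0 t1 e subrr Normc.normc0 => /(_ isT).
by apply/negP; rewrite -ltNge lt_min t0 subr_gt0.
Qed.

(** A geometric sum of powers of [expe (n / p)] over a full period, minus its term [a = 0]. *)
Lemma sum_cos_farey {R : realType} (Q n p : nat) : (0 < p <= Q)%N ->
  \sum_(a < Q.+1 | (0 < a < p)%N) cos (2 * pi * (n%:R * (a%:R / p%:R))) =
  p%:R * (p %| n)%:R - 1 :> R.
Proof.
move=> /andP[p0 pQ]; have pR : 0 < p%:R :> R by rewrite ltr0n.
pose z : R[i] := expe (n%:R / p%:R).
pose F a : R := complex.Re (z ^+ a).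
transitivity (\sum_(1 <= a < p) F a).
  rewrite (big_nat_widen _ _ Q.+1); last by lia.
  rewrite (big_nat_widenl _ 0)//= big_mkord; apply: eq_big => [a|a _].
    by rewrite andbC.
  rewrite /F -expeM_nat Re_expe; congr (cos (_ * _)).
  by field; rewrite gt_eqF.
have -> : \sum_(1 <= a < p) F a = complex.Re (\sum_(a < p) z ^+ a) - 1.
  rewrite Re_sum -(big_mkord xpredT F) [in RHS]big_ltn// /F expr0 /=; ring.
congr (_ - 1).
case: (boolP (p %| n)%N) => [/dvdnP[k nk]|pn].
  have z1 : z = 1.
    rewrite /z nk natrM mulfK ?expe_nat// gt_eqF//.
  rewrite mulr1 z1; under eq_bigr do rewrite expr1n.
  by rewrite sumr_const card_ord -[1]/((1%:C)%C) -rmorphMn.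
have z1 : z != 1 by exact: expe_frac_neq1.
have zp : z ^+ p = 1.
  by rewrite -expeM_nat mulrC divfK ?expe_nat// gt_eqF.
have : (z - 1) * \sum_(a < p) z ^+ a = 0 by rewrite -subrX1 zp subrr.
move/eqP; rewrite mulf_eq0 subr_eq0 (negbTE z1) /= => /eqP->.
by rewrite mulr0.
Qed.

(** Take [N = Q^2]: then [sqrt N = Q], and [900 p <= N] for all [p <= Q] because [Q >= 900]. The 30
    is 5 times 6. *)
Lemma sum_sqrt_primes_le_Rintegral {R : realType} (X : R) (Q : nat) :
  (900 <= Q)%N -> (Q ^ 2 <= Num.truncn X)%N ->
  Q%:R * \sum_(0 <= p < Q.+1 | prime p) Num.sqrt p%:R <=
  30 * Q%:R ^+ 2 * harmonic_sum (Q ^ 2) ^+ 2 *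
     \int[lebesgue_measure]_(a in `[0, 1]) normc (liouville_sum X a).
Proof.
move=> Q900 QX; have Q2 : (0 < Q ^ 2)%N by rewrite expn_gt0; lia.
have := sum_farey_le_Rintegral Q2 QX (leqnn _).
rewrite -(pair_big_dep (fun p : 'I_Q.+1 => prime p) (fun p a : 'I_Q.+1 => (0 < a < p)%N)
  (fun p a : 'I_Q.+1 => \sum_(1 <= n < (Q ^ 2).+1) (liouville n)%:~R * weight (Q ^ 2) n *
     cos (2 * pi * (n%:R * (a%:R / p%:R))))) /=.
set I := Rintegral _ _ _ => h.
have {}h : \sum_(p < Q.+1 | prime p) 1 / 5 * (Num.sqrt p%:R * Num.sqrt (Q ^ 2)%:R) <=
    6 * (Q ^ 2)%:R * harmonic_sum (Q ^ 2) ^+ 2 * I.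
  apply: le_trans h; apply: ler_sum => p pp.
  rewrite exchange_big /=.
  under eq_bigr do rewrite -big_distrr /= sum_cos_farey ?prime_gt0 ?(leq_ord p)//.
  apply: ramanujan_correlation_ge => //.
  by rewrite -mulnn leq_mul// leq_ord.
rewrite big_mkord.
have e : Num.sqrt (Q ^ 2)%:R = Q%:R :> R by rewrite natrX sqrtr_sqr ger0_norm.
move: h; under eq_bigr do rewrite e mulrCA.
rewrite -big_distrl /= natrX; set S := \sum_(_ < _ | _) _; nra.
Qed.

(** With [P = prime_pi Q], at most [T = floor(P / 2)] primes are at most [T]. So at least [P / 2] of
    them exceed [T], hence are at least [P / 2]. *)
Lemma sum_sqrt_primes_ge {R : realType} (Q : nat) :
  (prime_pi Q)%:R / 2 * Num.sqrt ((prime_pi Q)%:R / 2) <=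
  \sum_(0 <= p < Q.+1 | prime p) Num.sqrt p%:R :> R.
Proof.
set P := prime_pi Q; set T := P./2.
have PR : P%:R = \sum_(0 <= p < Q.+1 | prime p) (1 : R).
  by rewrite /P /prime_pi natr_sum.
have PT : P%:R <= 2 * T%:R + 1 :> R.
  by rewrite -natrM natr1 ler_nat -[X in (X <= _)%N](odd_double_half P) -/T; case: (odd P); lia.
have TP : 2 * T%:R <= P%:R :> R.
  by rewrite -natrM ler_nat -[X in (_ <= X)%N](odd_double_half P) -/T; case: (odd P); lia.
have small : \sum_(0 <= p < Q.+1 | prime p) ((p <= T)%N)%:R <= T%:R :> R.
  apply: (@le_trans _ _ (\sum_(0 <= p < Q.+1) ((0 < p <= T)%N)%:R)).
    rewrite big_mkcond /=; apply: ler_sum => p _.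
    by case: ifP => // /prime_gt0 ->.
  have count M : (\sum_(0 <= p < M) (0 < p <= T) = minn T M.-1)%N.
    elim: M => [|M IH]; first by rewrite big_geq// minn0.
    by rewrite big_nat_recr//= IH; case: M {IH} => [|M] /=; case: leqP; lia.
  by rewrite -natr_sum count ler_nat geq_minl.
set r := Num.sqrt (P%:R / 2).
have r0 : 0 <= r by exact: sqrtr_ge0.
apply: (@le_trans _ _ (\sum_(0 <= p < Q.+1 | prime p) r * (1 - ((p <= T)%N)%:R))).
  rewrite -big_distrr /= sumrB -PR mulrC ler_wpM2l//; lra.
apply: ler_sum => p _; case: leqP => hp; first by rewrite subrr mulr0 sqrtr_ge0.
rewrite subr0 mulr1 ler_wsqrtr//.
have : T%:R + 1 <= p%:R :> R by rewrite natr1 ler_nat.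
lra.
Qed.

Lemma ln2_ge_half {R : realType} : 1 / 2 <= ln 2 :> R.
Proof.
have := @le_ln1Dx R (- (1 / 2)); rewrite (_ : 1 - 1 / 2 = 2^-1); last by field.
by rewrite lnV ?posrE//; lra.
Qed.

(** Logarithms of the Chebyshev bound at [n = floor(Q / 2)]. The 6 comes from [Q <= 3n] and
    [ln 2 >= 1/2]. *)
Lemma prime_pi_ge {R : realType} (Q : nat) : (2 <= Q)%N ->
  Q%:R <= 6 * (prime_pi Q)%:R * ln Q%:R :> R.
Proof.
move=> Q2; set n := Q./2; have n0 : (0 < n)%N by rewrite /n; lia.
have nQ : (n.*2 <= Q)%N by rewrite /n; lia.
have Qn : (Q <= 3 * n)%N by rewrite /n; lia.
have n2 : 0 < n.*2%:R :> R by rewrite ltr0n double_gt0.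
have h : n%:R * ln 2 <= (prime_pi n.*2)%:R * ln n.*2%:R :> R.
  have : (2 ^ n)%:R <= (n.*2 ^ prime_pi n.*2)%:R :> R by rewrite ler_nat prime_pi_lower.
  rewrite (natrX R 2 n) (natrX R n.*2 (prime_pi n.*2)) => h.
  rewrite [n%:R * _]mulr_natl [X in _ <= X]mulr_natl -!lnXn//.
  by rewrite ler_ln ?posrE ?exprn_gt0.
have pm : (prime_pi n.*2 <= prime_pi Q)%N.
  by rewrite /prime_pi [X in (_ <= X)%N](big_cat_nat (n := n.*2.+1))//= leq_addr.
have h1 : ln (n.*2%:R) <= ln (Q%:R) :> R by rewrite ler_ln ?posrE ?ler_nat ?ltr0n//; lia.
have h2 : 0 <= ln (n.*2%:R) :> R by rewrite ln_ge0// ler1n double_gt0.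
have h3 : (prime_pi n.*2)%:R <= (prime_pi Q)%:R :> R by rewrite ler_nat.
have h4 : Q%:R <= 3 * n%:R :> R by rewrite -natrM ler_nat.
have h5 := @ln2_ge_half R.
have h6 : 1 / 2 * n%:R <= ln 2 * n%:R :> R by rewrite ler_wpM2r.
have h7 : ln n.*2%:R * (prime_pi n.*2)%:R <= ln Q%:R * (prime_pi Q)%:R :> R by rewrite ler_pM.
lra.
Qed.

Lemma harmonic_sum_le {R : realType} (N : nat) : (0 < N)%N ->
  harmonic_sum N <= 1 + ln N%:R :> R.
Proof.
elim: N => // N IH _; case: (posnP N) => [->|N0].
  by rewrite /harmonic_sum big_nat1 invr1 ln1 addr0.
rewrite /harmonic_sum big_nat_recr//= -/(harmonic_sum N).
have NR : 0 < N%:R :> R by rewrite ltr0n.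
have N1 : 0 < N.+1%:R :> R by rewrite ltr0n.
have := @le_ln1Dx R (- N.+1%:R^-1).
have -> : 1 - N.+1%:R^-1 = N%:R / N.+1%:R :> R.
  by rewrite -natr1 in N1 *; field; rewrite gt_eqF.
rewrite ln_div ?posrE// => h.
have h1 : -1 < - N.+1%:R^-1 :> R by rewrite ltrN2 invf_lt1// ltr1n.
apply: le_trans (lerD (IH N0) (lexx _)) _; move: (h h1).
move: (ln N%:R) (ln N.+1%:R) (N.+1%:R^-1) => a b c; lra.
Qed.

Lemma ln_le_powR {R : realType} (d x : R) : 0 < d -> 0 < x -> ln x <= d^-1 * x `^ d.
Proof.
move=> d0 x0; rewrite mulrC ler_pdivlMr// mulrC -ln_powR ltW// ln_sublinear//.
exact: powR_gt0.
Qed.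

(** [L = 1 + 2 ln Q] majorises both the harmonic sum and [ln Q]. Chebyshev gives
    [Q sqrt Q <= 48 L^2 S] for the sum [S] of square roots of primes, and the integral gives
    [S <= 30 Q L^2 I]; the constant is 48 times 30. *)
Lemma sqrt_le_Rintegral {R : realType} (X : R) (Q : nat) :
  (900 <= Q)%N -> (Q ^ 2 <= Num.truncn X)%N ->
  Num.sqrt Q%:R <= 1440 * (1 + 2 * ln Q%:R) ^+ 4 *
    \int[lebesgue_measure]_(a in `[0, 1]) normc (liouville_sum X a).
Proof.
move=> Q900 QX; have hI := sum_sqrt_primes_le_Rintegral Q900 QX.
set I := Rintegral _ _ _ in hI *.
have I0 : 0 <= I.
  by apply: Rintegral_ge0 => a _; exact: le_trans (normr_ge0 _) (normc_ge_normr_Re _).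
have Q0 : 0 < Q%:R :> R by rewrite ltr0n (leq_trans _ Q900).
have Q1 : 1 <= Q%:R :> R by rewrite ler1n (leq_trans _ Q900).
set l : R := ln Q%:R; have l0 : 0 <= l by rewrite ln_ge0.
set L := 1 + 2 * l; have L1 : 1 <= L by rewrite /L; lra.
have hH : harmonic_sum (Q ^ 2) <= L :> R.
  have Q2 : (0 < Q ^ 2)%N by rewrite expn_gt0 (leq_trans _ Q900).
  have := @harmonic_sum_le R _ Q2; rewrite (natrX R Q 2) lnXn// -/l => h.
  by apply: le_trans h _; rewrite /L mulr2n; lra.
have H0 : 0 <= harmonic_sum (Q ^ 2) :> R.
  by apply: sumr_ge0 => i _; rewrite invr_ge0.
set u : R := (prime_pi Q)%:R / 2; set S := \sum_(0 <= p < _ | _) _ in hI.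
have u0 : 0 <= u by rewrite divr_ge0.
have hS : u * Num.sqrt u <= S by exact: sum_sqrt_primes_ge.
have hu : Q%:R <= 12 * L * u.
  have /(@prime_pi_ge R) : (2 <= Q)%N by exact: leq_trans Q900.
  rewrite -/l /u => h; apply: le_trans h _.
  have : 0 <= (prime_pi Q)%:R :> R by [].
  by rewrite /L; nra.
set q := Num.sqrt Q%:R; set v := Num.sqrt u in hS.
have q0 : 0 < q by rewrite sqrtr_gt0.
have v0 : 0 <= v by exact: sqrtr_ge0.
have qq : q * q = Q%:R by rewrite -expr2 sqr_sqrtr// ltW.
have vv : v * v = u by rewrite -expr2 sqr_sqrtr.
(* The square root of [hu], after [12 L <= 16 L^2]. *)
have qv : q <= 4 * L * v.
  have Lv0 : 0 <= 4 * L * v by rewrite !mulr_ge0//; lra.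
  rewrite -(@ler_pXn2r _ 2) ?nnegrE ?(ltW q0)//.
  have -> : q ^+ 2 = Q%:R by rewrite expr2.
  have -> : (4 * L * v) ^+ 2 = 16 * L ^+ 2 * u by rewrite -vv; ring.
  apply: le_trans hu _; rewrite ler_wpM2r//; nra.
have L0 : 0 <= L by lra.
have h1 : Q%:R * q <= 48 * L ^+ 2 * S.
  apply: (@le_trans _ _ (12 * L * u * (4 * L * v))).
    by apply: ler_pM => //; exact: ltW.
  have -> : 12 * L * u * (4 * L * v) = 48 * L ^+ 2 * (u * v) by ring.
  by rewrite ler_wpM2l// mulr_ge0// exprn_ge0.
have h2 : Q%:R * S <= 30 * Q%:R ^+ 2 * L ^+ 2 * I.
  apply: le_trans hI _; rewrite ler_wpM2r// ler_wpM2l ?mulr_ge0 ?exprn_ge0//.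
  by rewrite ler_pXn2r.
have h3 : S <= 30 * Q%:R * L ^+ 2 * I.
  rewrite -(ler_pM2l Q0); apply: le_trans h2 _.
  by have -> : Q%:R * (30 * Q%:R * L ^+ 2 * I) = 30 * Q%:R ^+ 2 * L ^+ 2 * I by ring.
rewrite -(ler_pM2l Q0); apply: le_trans h1 _.
have -> : Q%:R * (1440 * L ^+ 4 * I) = 48 * L ^+ 2 * (30 * Q%:R * L ^+ 2 * I) by ring.
by rewrite ler_wpM2l// mulr_ge0// exprn_ge0.
Qed.

Theorem theorem1p1 (R : realType) (eps : R) (eps_gt0 : 0 < eps) :
  exists2 c : R, 0 < c &
    \forall X \near +oo,
      c * X `^ (1 / 4 - eps) <=
        \int[lebesgue_measure]_(a in `[0, 1]) ComplexField.Normc.normc (liouville_sum X a).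
Proof.
(* The fourth power of the logarithm costs [Q^(4d) = Q^(2 eps)], which is at most [X^eps] because
   [Q <= sqrt X]. *)
set d := eps / 2; have d0 : 0 < d by rewrite divr_gt0.
set C : R := 1 + 2 * d^-1; have C0 : 0 < C.
  by have : 0 < d^-1 by [rewrite invr_gt0]; rewrite /C; lra.
have k0 : 0 < 1440 :> R by rewrite ltr0n.
pose K : R := 1440 * C ^+ 4; have K0 : 0 < K by exact: mulr_gt0 k0 (exprn_gt0 _ C0).
(* [K] absorbs 1440 and the fourth power of the logarithm; the 2 comes from replacing [sqrt Q] by
   [X^(1/4)]. *)
exists (2 * K)^-1; first by rewrite invr_gt0 mulr_gt0.
near=> X.
have X1 : 900 ^+ 2 <= X by near: X; apply: nbhs_pinfty_ge; exact: num_real.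
have n900 : 0 < 900 :> R by rewrite ltr0n.
have X0 : 0 < X by apply: lt_le_trans X1; exact: exprn_gt0.
set s := Num.sqrt X; set Q := Num.truncn s.
have s0 : 0 <= s by exact: sqrtr_ge0.
have ss : s ^+ 2 = X by rewrite sqr_sqrtr// ltW.
have Qs : Q%:R <= s by rewrite truncn_le.
have sQ : s < Q%:R + 1 by rewrite natr1; exact: truncnS_gt.
have s900 : 900 <= s.
  by rewrite -(@ler_pXn2r _ 2) ?nnegrE ?(ltW n900)// ss.
have Q900 : (900 <= Q)%N by rewrite truncn_ge_nat.
have QX : (Q ^ 2 <= Num.truncn X)%N.
  rewrite truncn_ge_nat ?(ltW X0)// (natrX R Q 2); apply: le_trans (_ : s ^+ 2 <= _).
    by rewrite ler_pXn2r ?nnegrE.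
  by rewrite ss.
have := sqrt_le_Rintegral Q900 QX.
set I := Rintegral _ _ _ => h.
have I0 : 0 <= I.
  by apply: Rintegral_ge0 => a _; exact: le_trans (normr_ge0 _) (normc_ge_normr_Re _).
have Q1 : 1 <= Q%:R :> R by rewrite ler1n (leq_trans _ Q900).
have Q0 : 0 < Q%:R :> R by lra.
have hL : 1 + 2 * ln Q%:R <= C * Q%:R `^ d.
  have h1 := ln_le_powR d0 Q0.
  have h2 : 1 <= Q%:R `^ d by have := ler_powR Q1 (ltW d0); rewrite powRr0.
  have -> : C * Q%:R `^ d = Q%:R `^ d + 2 * (d^-1 * Q%:R `^ d) by rewrite /C; ring.
  by rewrite lerD// ler_wpM2l.
have L0 : 0 <= 1 + 2 * ln Q%:R :> R by have := ln_ge0 Q1; lra.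
have hL4 : (1 + 2 * ln Q%:R) ^+ 4 <= C ^+ 4 * X `^ eps.
  apply: (@le_trans _ _ ((C * Q%:R `^ d) ^+ 4)).
    by rewrite ler_pXn2r ?nnegrE ?mulr_ge0 ?powR_ge0// ltW.
  rewrite exprMn ler_wpM2l ?exprn_ge0 ?(ltW C0)//.
  rewrite -powR_mulrn ?powR_ge0// -powRrM -ss -(@powR_mulrn _ s 2)// -powRrM.
  have -> : d * 4 = 2 * eps by rewrite /d; field.
  by rewrite ge0_ler_powR ?nnegrE//; lra.
(* With [s = sqrt X], [s < Q + 1 <= 4 Q], and taking square roots gives the factor 2. *)
have hX : X `^ (1 / 4) <= 2 * Num.sqrt Q%:R.
  have -> : X `^ (1 / 4) = Num.sqrt s.
    have e : s = X `^ 2^-1 by rewrite powR12_sqrt// ltW.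
    by rewrite -(powR12_sqrt s0) e -powRrM; congr (_ `^ _); field.
  have -> : 2 = Num.sqrt 4 :> R by rewrite (_ : 4 = 2 ^+ 2) ?sqrtr_sqr ?ger0_norm//; ring.
  rewrite -sqrtrM// ler_wsqrtr//; lra.
have Xe : 0 < X `^ eps by exact: powR_gt0.
rewrite powRB; last by rewrite (gt_eqF X0) implybT.
rewrite ler_pdivrMl ?mulr_gt0// ler_pdivrMr//.
have h5 : 1440 * (1 + 2 * ln Q%:R) ^+ 4 * I <= K * X `^ eps * I.
  by rewrite ler_wpM2r// /K -mulrA (ler_pM2l k0).
apply: le_trans hX _.
have -> : 2 * K * I * X `^ eps = 2 * (K * X `^ eps * I) by ring.
by rewrite ler_pM2l// (le_trans h).
Unshelve. all: by end_near.
Qed.
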